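(* Let $d\ge 1$ be an integer and let $X=\{X(t),\,t\in\mathbb{R}\}$ be a second-order stochastic process on the real line. Assume the following condition: the $d$-th derivative (or generalized derivative) $Y=X^{(d)}$ is a stationary random process whose correlation function $C_y(h)=E\bigl(Y(t+h)Y(t)\bigr)$ satisfies $\int_{-\infty}^{\infty}|C_y(h)|^2\,dh<\infty$, and the random variables $X_0,X_1,\dots,X_{d-1}$ appearing in the spectral representation of $X$ (recalled in the context) are zero. Then $X$ is an intrinsic random function of order $d$ (IRF($d$)) on $\mathbb{R}$ if and only if $X$ is a random process with stationary increments of order $d$ (I($d$)).
   Context: Stationarity: a random process $W$ on $\mathbb{R}$ is (weakly) stationary if $E(W(t))=E(W(t+h))$ and $\mathrm{Cov}(W(t),W(s))=\mathrm{Cov}(W(t+h),W(s+h))$ for all $t,s,h\in\mathbb{R}$. Stationary increments, I($d$): for $t,\iota\in\mathbb{R}$ put $\Delta_\iota^d X(t)=\sum_{k=0}^{d}(-1)^k\binom{d}{k}X(t-k\iota)$. The process $X$ is a random process with stationary increments of order $d$, I($d$), if for every $\iota\in\mathbb{R}$ the process $t\mapsto\Delta_\iota^dX(t)$ is stationary. Allowable measures: $\Lambda_d$ is the set of finite signed measures $\lambda$ on $\mathbb{R}$ with compact support that annihilate polynomials of degree less than $d$, i.e. $\int p(x)\,\lambda(dx)=0$ for every polynomial $p$ of degree less than $d$. For a function or process $f$ write $f(\lambda)=\int f(x)\,\lambda(dx)$; for a process $X$, $X(\lambda)=\int X(t)\,\lambda(dt)$ is a mean-square integral. For $h\in\mathbb{R}$,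 the shifted measure $\tau_h\lambda$ is given by $f(\tau_h\lambda)=\int f(x+h)\,\lambda(dx)$. Intrinsic random function, IRF($d$): $X$ is an IRF($d$) if for all $\lambda,\lambda_1,\lambda_2\in\Lambda_d$ and all $h\in\mathbb{R}$, $E(X(\lambda))=E(X(\tau_h\lambda))$ and $\mathrm{Cov}(X(\lambda_1),X(\lambda_2))=\mathrm{Cov}(X(\tau_h\lambda_1),X(\tau_h\lambda_2))$. Spectral representation (Yaglom, recalled to give meaning to $X_0,\dots,X_{d-1}$): the stationary process $Y=X^{(d)}$ has the representations $Y(t)=\int_{-\infty}^{\infty}e^{i\omega t}\,dZ_y(\omega)$ and $C_y(h)=\int_{-\infty}^{\infty}e^{i\omega h}\,dF_y(\omega)$, where $F_y$ is bounded and non-decreasing, $Z_y$ is a random function with uncorrelated increments, and $E(|dZ_y(\omega)|^2)=dF_y(\omega)$. Then $$X(t)=\int_{-\infty}^{\infty}\Bigl(e^{it\omega}-1-it\omega-\cdots-\frac{(it\omega)^{d-1}}{(d-1)!}\Bigr)dZ(\omega)+X_0+X_1t+\cdots+X_dt^d,$$ where $Z(\omega_2)-Z(\omega_1)=\int_{\omega_1}^{\omega_2}\frac{dZ_y(\omega)}{(i\omega)^d}$, the integral over $(-\infty,\infty)$ with respect to $dZ$ is $\lim_{T\to\infty,\,\epsilon\to0}\{\int_{-T}^{-\epsilon}+\int_{\epsilon}^{T}\}$ (limit in mean square), and $X_0,\dots,X_d$ are random variables ($X_0=X(0)$, and $X_d$ accounts for a jump at $\omega=0$). When $\int|C_y(h)|^2dh<\infty$,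 it is known that $X_d=0$, so with $X_0=\cdots=X_{d-1}=0$ one has $X(t)=\int_{-\infty}^{\infty}\bigl(e^{it\omega}-\sum_{k=0}^{d-1}\frac{(it\omega)^k}{k!}\bigr)dZ(\omega)$. *)

(* Defs.v *)
From HB Require Import structures.
From mathcomp Require Import all_boot all_order all_algebra.
From mathcomp Require Import all_classical all_reals all_analysis.
From mathcomp Require Import complex.

Set Implicit Arguments.
Unset Strict Implicit.
Unset Printing Implicit Defensive.

Import Order.TTheory GRing.Theory Num.Theory.
Import numFieldNormedType.Exports.

Local Open Scope classical_set_scope.
Local Open Scope ring_scope.
Local Open Scope complex_scope.

Section MeanSquare.
Context (disp : measure_display) (T : measurableType disp) (R : realType).
Variable P : probability T R.
Implicit Types (U V I : T -> R[i]) (W X Y : R -> T -> R) (Z : R -> T -> R[i]).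

Definition sqmod (z : R[i]) : R := complex.Re z ^+ 2 + complex.Im z ^+ 2.

Definition toC (U : T -> R) : T -> R[i] := fun x => (U x)%:C.

Definition L2C U : Prop :=
  ((fun x => complex.Re (U x)) \in Lfun P 2%:E) /\
  ((fun x => complex.Im (U x)) \in Lfun P 2%:E).

Definition ms_sqdist U V : \bar R := 'E_P[fun x => sqmod (U x - V x)%R]%E.

Definition ms_orthogonal U V : Prop :=
  ('E_P[fun x => complex.Re (U x * conjc (V x))%R] = 0)%E /\
  ('E_P[fun x => complex.Im (U x * conjc (V x))%R] = 0)%E.

Definition second_order W : Prop := forall t, W t \in Lfun P 2%:E.

Definition stationary W : Prop :=
  (forall t h : R, 'E_P[W t] = 'E_P[W (t + h)%R])%E /\
  (forall t s h : R,
     covariance P (W t) (W s) = covariance P (W (t + h)) (W (s + h))).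

Definition difference (d : nat) (iota : R) X : R -> T -> R :=
  fun t x => \sum_(k < d.+1) (-1) ^+ k * 'C(d, k)%:R * X (t - k%:R * iota) x.

Definition stationary_increments (d : nat) X : Prop :=
  forall iota : R, stationary (difference d iota X).

(* Mean-square limit of the sums of Phi (tag_i) t_i t_{i+1} over the tagged
   partitions a = t_0 < ... < t_n = b, as the mesh tends to 0. The sequence s
   lists t_1, ..., t_n. *)
Definition ms_integral (Phi : R -> R -> R -> T -> R[i]) (a b : R) I : Prop :=
  L2C I /\
  forall eps : R, 0 < eps -> exists2 delta : R, 0 < delta &
    forall (s : seq R) (tag : nat -> R), itv_partition a b s ->
      (forall i, (i < size s)%N ->
         nth b (a :: s) i <= tag i <= nth b (a :: s) i.+1 /\
         nth b (a :: s) i.+1 - nth b (a :: s) i < delta) ->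
      (ms_sqdist (fun x => (\sum_(i < size s)
          Phi (tag i) (nth b (a :: s) i) (nth b (a :: s) i.+1) x)%R) I
        <= eps%:E)%E.

Definition stieltjes (g : R -> R[i]) Z (a b : R) I : Prop :=
  ms_integral (fun s u v x => g s * (Z v x - Z u x)) a b I.

Definition stieltjes_line (g : R -> R[i]) Z I : Prop :=
  L2C I /\ exists J : R -> T -> R[i],
    (forall A : R, 0 < A -> stieltjes g Z (- A) A (J A)) /\
    ms_sqdist (J A) I @[A --> +oo%R] --> 0%E.

(* The same, with a neighbourhood of the origin removed:
   lim_{A -> oo, e -> 0} of the integral over [-A, -e] plus that over [e, A]. *)
Definition stieltjes_punctured (g : R -> R[i]) Z I : Prop :=
  L2C I /\ exists J1 J2 : R -> R -> T -> R[i],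
    (forall e A : R, 0 < e -> e < A ->
       stieltjes g Z (- A) (- e) (J1 e A) /\ stieltjes g Z e A (J2 e A)) /\
    ms_sqdist (fun x => J1 p.1 p.2 x + J2 p.1 p.2 x) I
      @[p --> filter_prod (0 : R)^'+ (pinfty_nbhs R)] --> 0%E.

Definition ms_derivative X Y : Prop :=
  second_order Y /\
  forall t : R,
    ms_sqdist (toC (fun x => h^-1 * (X (t + h) x - X t x))) (toC (Y t))
      @[h --> (0 : R)^'] --> 0%E.

Fixpoint ms_nderivative (d : nat) X Y : Prop :=
  if d is d'.+1 then
    exists2 X' : R -> T -> R, ms_derivative X X' & ms_nderivative d' X' Y
  else forall t, {ae P, forall x, X t x = Y t x}.

Definition test_function (a b : R) (phi : R -> R) : Prop :=
  (forall n x, derivable (derive1n n phi) x 1) /\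
  (forall x, x \notin `[a, b] -> phi x = 0).

Definition generalized_nderivative (d : nat) X Y : Prop :=
  forall (a b : R) (phi : R -> R), a < b -> test_function a b phi ->
  exists I J : T -> R,
    [/\ ms_integral (fun s u v => toC (fun x => derive1n d phi s * X s x * (v - u)))
          a b (toC I),
        ms_integral (fun s u v => toC (fun x => phi s * Y s x * (v - u)))
          a b (toC J) &
        {ae P, forall x, I x = (-1) ^+ d * J x}].

Definition cis (theta : R) : R[i] := cos theta +i* sin theta.

(* "Uncorrelated" increments are taken with uncentred second moments, as are
   the correlation function E(Y(t + h) Y(t)) and E|dZ|^2 = dF. *)
Definition uncorrelated_increments Z : Prop :=
  (forall w1 w2 : R, w1 <= w2 -> L2C (fun x => Z w2 x - Z w1 x)) /\
  (forall w1 w2 w3 w4 : R, w1 <= w2 -> w2 <= w3 -> w3 <= w4 ->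
     ms_orthogonal (fun x => Z w2 x - Z w1 x) (fun x => Z w4 x - Z w3 x)).

(* The last clause, C(h) = int e^{iwh} dF(w), is the deterministic instance of
   the stochastic integral. *)
Definition spectral_stationary Y (C : R -> R) Zy (F : R -> R) : Prop :=
  [/\ {homo F : w1 w2 / w1 <= w2} /\ (exists M : R, forall w, `|F w| <= M),
      uncorrelated_increments Zy,
      forall w1 w2 : R, w1 <= w2 -> ms_sqdist (Zy w2) (Zy w1) = (F w2 - F w1)%:E,
      forall t, stieltjes_line (fun w => cis (w * t)) Zy (toC (Y t)) &
      forall h, stieltjes_line (fun w => cis (w * h))
                  (fun w => cst (F w)%:C) (cst (C h)%:C)].

Definition taylor_kernel (d : nat) (t w : R) : R[i] :=
  cis (t * w) - \sum_(k < d) (0 +i* (t * w)) ^+ k / (k`!)%:R.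

(* Z is only determined up to additive constants on each half-line, and its
   value at 0 plays no role. *)
Definition spectral_representation (d : nat) X Zy Z (Xk : nat -> T -> R) : Prop :=
  (forall w1 w2 : R, w1 <= w2 -> (0 < w1) || (w2 < 0) ->
     stieltjes (fun w => ((0 +i* w) ^+ d)^-1) Zy w1 w2
       (fun x => Z w2 x - Z w1 x)) /\
  (forall t : R, exists2 I : T -> R[i],
     stieltjes_punctured (taylor_kernel d t) Z I &
     {ae P, forall x,
        (X t x)%:C = I x + (\sum_(k < d.+1) Xk k x * t ^+ k)%:C}).

End MeanSquare.

Section Allowable.
Context (R : realType).
Implicit Types (lam : {charge set (measurableTypeR R) -> \bar R}).

(* The Hahn decomposition picked by cid is unique up to null sets, so the value
   does not depend on it. *)
Definition charge_integral lam (f : R -> R) : \bar R :=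
  let HP := cid (Hahn_decomposition lam) in
  let HN := cid (projT2 HP) in
  (\int[jordan_pos (projT2 HN)]_x (f x)%:E -
   \int[jordan_neg (projT2 HN)]_x (f x)%:E)%E.

Definition concentrated lam (D : set R) : Prop :=
  forall A : set (measurableTypeR R), measurable A -> A `&` D = set0 ->
    lam A = 0%E.

Definition allowable (d : nat) lam : Prop :=
  (exists2 K : set R, compact K & concentrated lam K) /\
  (forall p : {poly R}, (size p <= d)%N ->
     charge_integral lam (fun x => p.[x]) = 0%E).

Lemma measurable_addr (h : R) :
  measurable_fun [set: measurableTypeR R]
    (fun x : measurableTypeR R => (x + h : measurableTypeR R)).
Proof. by apply: measurable_realfun.measurable_funD. Qed.

Section Shift.
Variables (h : R) (lam : {charge set (measurableTypeR R) -> \bar R}).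

Definition shift_charge : set (measurableTypeR R) -> \bar R :=
  pushforward lam (fun x : measurableTypeR R => (x + h : measurableTypeR R)).

HB.instance Definition _ := Charge.copy shift_charge
  (measure_function_pushforward__canonical__charge_Charge lam (measurable_addr h)).

End Shift.

End Allowable.

Section IntrinsicRandomFunction.
Context (disp : measure_display) (T : measurableType disp) (R : realType).
Variable P : probability T R.
Implicit Types (X : R -> T -> R) (lam : {charge set (measurableTypeR R) -> \bar R}).

(* X(lam) as a mean-square limit of Riemann sums. The value of I does not
   depend, up to null sets, on the interval ]a, b] carrying lam. *)
Definition process_integral X lam (I : T -> R) : Prop :=
  exists a b : R, [/\ a < b, concentrated lam `]a, b]%classic &
    ms_integral P (fun s u v => toC (fun x => X s x * fine (lam `]u, v]%classic)))
      a b (toC I)].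

Definition intrinsic_random_function (d : nat) X : Prop :=
  [/\ forall lam, allowable d lam -> exists I, process_integral X lam I,
      forall lam (h : R) I J, allowable d lam ->
        process_integral X lam I ->
        process_integral X (shift_charge h lam) J ->
        'E_P[I]%E = 'E_P[J]%E &
      forall lam1 lam2 (h : R) I1 I2 J1 J2, allowable d lam1 ->
        allowable d lam2 ->
        process_integral X lam1 I1 -> process_integral X lam2 I2 ->
        process_integral X (shift_charge h lam1) J1 ->
        process_integral X (shift_charge h lam2) J2 ->
        covariance P I1 I2 = covariance P J1 J2].

End IntrinsicRandomFunction.

(* Main.v *)
Require Import Defs.
From HB Require Import structures.
From mathcomp Require Import all_boot all_order all_algebra.
From mathcomp Require Import all_classical all_reals all_analysis.
From mathcomp Require Import complex.
From mathcomp Require Import measurable_realfun lra ring.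

(** Let [m] be the mean and [K] the covariance of [X]. When [X] is locally
    Lipschitz in mean square, [X(lambda)] exists for every compactly supported signed
    measure, its mean is the integral of [m], and the covariance of [X(lambda1)] and
    [X(lambda2)] is the iterated integral of [K] ([ip_process_integral],
    [process_integral_exists], [cov_process_integral_l]). So [X] is an IRF([d]) iff,
    for all [h], the allowable measures annihilate [m (t + h) - m t], and their
    products annihilate [D s t = K (s + h) (t + h) - K s t]. It is I([d]) iff the same
    holds for the measures that represent differences of order [d], with equal steps
    in the two factors. These measures are allowable and have finite support, which
    gives one implication ([stationary_increments_of_intrinsic]).

    For the converse, a locally Lipschitz function all of whose differences of order
    [d] vanish is a polynomial of degree less than [d] ([fdiff_polynomial]); and if the
    double differences of [D] with equal steps vanish, then [D s t] is a sum of terms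
    each of which is a polynomial of degree less than [d] in [s] or in [t]
    ([fdiff2_polynomial]). Both are proved on the grids of step [1 / n], where
    vanishing differences are a recurrence that is solved by interpolation at the
    nodes [0, ..., d - 1], common to all the grids; continuity does the rest.
    Allowable measures annihilate such functions ([cint_fdiff_eq0],
    [cint2_fdiff_eq0]), hence [intrinsic_of_stationary_increments].

    The regularity of [X] comes from the spectral representation
    ([spectral_ms_locally_lipschitz]). The integrator [Z] has orthogonal increments
    and density [(i w) ^ - d] with respect to [Zy], so the second moment of the
    integral of [g] is at most a constant times the supremum of
    [|g w| ^ 2 / w ^ (2 d)] times the total variation of [F] ([csq_punctured]). The
    increment of the Taylor kernel between [s] and [t] is of order
    [|w| ^ d * |t - s|], for small and for large [w] alike
    ([taylor_kernel_lipschitz]). Therefore [X] is locally Lipschitz in mean square. *)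

Import Order.TTheory GRing.Theory Num.Theory.
Import numFieldNormedType.Exports.

Local Open Scope classical_set_scope.
Local Open Scope ring_scope.

Set Implicit Arguments.
Unset Strict Implicit.
Unset Printing Implicit Defensive.

(** * Square-integrable random variables as an inner product space *)
Section SquareIntegrable.
Context (disp : measure_display) (T : measurableType disp) (R : realType).
Variable P : probability T R.
Implicit Types (U V W : T -> R) (a : R).

Definition L2 U : Prop := U \in Lfun P 2%:E.

(** The mean of [U] is [ip U (cst 1)], so means, covariances and mean-square
    distances are all read off from this one bilinear form. *)
Definition ip U V : R := fine 'E_P[fun x => (U x * V x)%R]%E.

Definition nrm U : R := Num.sqrt (ip U U).

Lemma probability_fin_num : P [set: T] \is a fin_num.
Proof. exact: fin_num_measure. Qed.

Lemma L2_cst a : L2 (cst a).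
Proof. exact: Lfun_cst. Qed.

Lemma L2D U V : L2 U -> L2 V -> L2 (fun x => U x + V x).
Proof. by move=> hU hV; apply: rpredD => //; rewrite ?lee1n. Qed.

Lemma L2N U : L2 U -> L2 (fun x => - U x).
Proof. by move=> hU; rewrite /L2 (_ : (fun _ => _) = - U) // rpredN. Qed.

Lemma L2B U V : L2 U -> L2 V -> L2 (fun x => U x - V x).
Proof. by move=> hU hV; apply: L2D => //; apply: L2N. Qed.

Lemma L2Z a U : L2 U -> L2 (fun x => a * U x).
Proof.
move=> hU; rewrite /L2 (_ : (fun x => _) = a \o* U).
  by apply: Lfun_scale; rewrite // ler1n.
by apply/funext => x /=; rewrite mulrC.
Qed.

Lemma L2_sum n (F : 'I_n -> T -> R) : (forall i, L2 (F i)) ->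
  L2 (fun x => \sum_i F i x).
Proof.
move=> hF; rewrite (_ : (fun x => _) = \sum_i F i); last first.
  by apply/funext => x; rewrite fct_sumE.
by rewrite /L2; apply: rpred_sum => [|? i _]; [rewrite lee1n|exact: hF].
Qed.

Lemma L2_measurable U : L2 U -> measurable_fun [set: T] U.
Proof. by rewrite /L2 inE => /andP[/[!inE]]. Qed.

Lemma L2_L1 U : L2 U -> U \in Lfun P 1.
Proof. by apply: Lfun_subset12; exact: probability_fin_num. Qed.

Lemma L2M_L1 U V : L2 U -> L2 V -> (fun x => U x * V x) \in Lfun P 1.
Proof. exact: Lfun2_mul_Lfun1. Qed.

Lemma L2_of_sq U : measurable_fun [set: T] U ->
  ('E_P[fun x => (U x ^+ 2)%R] < +oo)%E -> L2 U.
Proof.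
move=> mU; rewrite unlock => lU.
rewrite /L2 inE; apply/andP; split; rewrite inE //=.
rewrite /finite_norm unlock poweR_lty//.
rewrite (le_lt_trans _ lU) // le_eqVlt; apply/orP; left; apply/eqP.
by apply: eq_integral => x _; rewrite /= powR_mulrn // real_normK // num_real.
Qed.

Lemma ipE U V : L2 U -> L2 V -> ('E_P[fun x => (U x * V x)%R] = (ip U V)%:E)%E.
Proof. by move=> hU hV; rewrite fineK // expectation_fin_num // L2M_L1. Qed.

Lemma ip1E U : L2 U -> ('E_P[U] = (ip U (cst 1))%:E)%E.
Proof.
move=> hU; rewrite -ipE //; last exact: L2_cst.
by congr ('E_P[_])%E; apply/funext => x /=; rewrite mulr1.
Qed.

Lemma ipC U V : ip U V = ip V U.
Proof. by rewrite /ip; congr (fine 'E_P[_])%E; apply/funext => x; rewrite mulrC. Qed.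

Lemma ipDl U V W : L2 U -> L2 V -> L2 W ->
  ip (fun x => U x + V x) W = ip U W + ip V W.
Proof.
move=> hU hV hW; apply: EFin_inj; rewrite EFinD -!ipE //; last exact: L2D.
rewrite -expectationD ?L2M_L1 //.
by congr ('E_P[_])%E; apply/funext => x /=; rewrite mulrDl.
Qed.

Lemma ipZl a U V : L2 U -> L2 V -> ip (fun x => a * U x) V = a * ip U V.
Proof.
move=> hU hV; apply: EFin_inj; rewrite EFinM -!ipE //; last exact: L2Z.
rewrite -expectationZl ?L2M_L1 //.
by congr ('E_P[_])%E; apply/funext => x /=; rewrite -mulrA mulrC.
Qed.

Lemma ipBl U V W : L2 U -> L2 V -> L2 W ->
  ip (fun x => U x - V x) W = ip U W - ip V W.
Proof.
move=> hU hV hW.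
rewrite (_ : (fun x => _) = fun x => U x + (-1) * V x); last first.
  by apply/funext => x; rewrite mulN1r.
by rewrite ipDl ?ipZl ?mulN1r //; exact: L2Z.
Qed.

Lemma ipDr U V W : L2 U -> L2 V -> L2 W ->
  ip W (fun x => U x + V x) = ip W U + ip W V.
Proof. by move=> *; rewrite ipC ipDl // !(ipC W). Qed.

Lemma ipZr a U V : L2 U -> L2 V -> ip V (fun x => a * U x) = a * ip V U.
Proof. by move=> *; rewrite ipC ipZl // (ipC V). Qed.

Lemma ip0l V : ip (fun=> 0) V = 0.
Proof.
rewrite /ip (_ : (fun x => _) = cst 0) ?expectation_cst //.
by apply/funext => x; rewrite mul0r.
Qed.

Lemma ip_suml n (F : 'I_n -> T -> R) V : (forall i, L2 (F i)) -> L2 V ->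
  ip (fun x => \sum_i F i x) V = \sum_i ip (F i) V.
Proof.
move=> hF hV; elim: n F hF => [|n IH] F hF.
  rewrite big_ord0 -[RHS](ip0l V); congr ip; apply/funext => x; exact: big_ord0.
rewrite big_ord_recr /= -IH // -ipDl //; last exact: L2_sum.
by congr ip; apply/funext => x; rewrite big_ord_recr.
Qed.

Lemma ip_ge0 U : 0 <= ip U U.
Proof. by apply: fine_ge0; apply: expectation_ge0 => x; rewrite -expr2 sqr_ge0. Qed.

Lemma nrm_ge0 U : 0 <= nrm U.
Proof. exact: sqrtr_ge0. Qed.

Lemma sqr_nrm U : nrm U ^+ 2 = ip U U.
Proof. by rewrite sqr_sqrtr // ip_ge0. Qed.

Lemma nrmZ a U : L2 U -> nrm (fun x => a * U x) = `|a| * nrm U.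
Proof.
move=> hU; rewrite /nrm ipZl ?ipZr //; last exact: L2Z.
by rewrite mulrA -expr2 sqrtrM ?sqr_ge0 // sqrtr_sqr.
Qed.

Lemma nrmN U : nrm (fun x => - U x) = nrm U.
Proof.
by rewrite /nrm /ip; congr (Num.sqrt (fine 'E_P[_]))%E; apply/funext => x; rewrite mulrNN.
Qed.

Lemma nrmBC U V : nrm (fun x => U x - V x) = nrm (fun x => V x - U x).
Proof. by rewrite -nrmN; congr nrm; apply/funext => x; rewrite opprB. Qed.

(** The quadratic [ip (U + t V) (U + t V)] in [t] is nonnegative: its minimum is
    taken at [- ip U V / ip V V], and when [ip V V] vanishes it is affine. *)
Lemma cauchy_schwarz U V : L2 U -> L2 V -> `|ip U V| <= nrm U * nrm V.
Proof.
move=> hU hV; rewrite -ler_sqr ?nnegrE ?mulr_ge0 ?nrm_ge0 //.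
rewrite real_normK ?num_real // exprMn !sqr_nrm.
set a := ip U U; set b := ip U V; set c := ip V V.
have Q t : 0 <= a + t * b *+ 2 + t ^+ 2 * c.
  have := ip_ge0 (fun x => U x + t * V x).
  have hVt := L2Z t hV.
  rewrite ipDl // ?ipDr ?ipZl ?ipZr //; last exact: L2D.
  rewrite ?ipZr // (ipC V U) -/a -/b -/c; congr (0 <= _); ring.
have a0 : 0 <= a := ip_ge0 U.
have c0 : 0 <= c := ip_ge0 V.
have [c_eq0|cn0] := eqVneq c 0.
  rewrite c_eq0 mulr0.
  have [->|bn0] := eqVneq b 0; first by rewrite expr0n.
  (* An affine function that is not constant takes the negative value [- a - 2]. *)
  have := Q (- (a + 1) / b); rewrite c_eq0 mulr0 addr0 mulfVK //; lra.
have cp : 0 < c by rewrite lt_def cn0.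
have := Q (- b / c); rewrite -(pmulr_rge0 _ cp).
suff -> : c * (a + - b / c * b *+ 2 + (- b / c) ^+ 2 * c) = a * c - b ^+ 2 by rewrite subr_ge0.
by field.
Qed.

Lemma nrmD U V : L2 U -> L2 V -> nrm (fun x => U x + V x) <= nrm U + nrm V.
Proof.
move=> hU hV; have hUV := L2D hU hV.
rewrite -ler_sqr ?nnegrE ?addr_ge0 ?nrm_ge0 // sqr_nrm.
rewrite ipDl // !ipDr // (ipC V U) sqrrD !sqr_nrm.
have := le_trans (ler_norm _) (cauchy_schwarz hU hV); lra.
Qed.

Lemma nrm_triangle U V W : L2 U -> L2 V -> L2 W ->
  nrm (fun x => U x - W x) <= nrm (fun x => U x - V x) + nrm (fun x => V x - W x).
Proof.
move=> hU hV hW; apply: le_trans (nrmD (L2B hU hV) (L2B hV hW)).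
by rewrite le_eqVlt; apply/orP; left; apply/eqP; congr nrm; apply/funext => x; ring.
Qed.

Lemma expectation_sqE U : L2 U -> ('E_P[fun x => (U x ^+ 2)%R] = (nrm U ^+ 2)%:E)%E.
Proof. by move=> hU; rewrite sqr_nrm -ipE. Qed.

Lemma covariance_ip U V : L2 U -> L2 V ->
  covariance P U V = (ip U V - ip U (cst 1) * ip V (cst 1))%:E.
Proof.
move=> hU hV; rewrite covarianceE ?L2M_L1 ?L2_L1 //.
by rewrite EFinB EFinM -!ip1E // -ipE.
Qed.

End SquareIntegrable.

(** * Mean-square completeness *)
Section Completeness.
Context (disp : measure_display) (T : measurableType disp) (R : realType).
Variable P : probability T R.

Lemma limn_einf_ub (u : nat -> \bar R) (c : \bar R) n :
  (forall m, (n <= m)%N -> (u m <= c)%E) -> (limn_einf u <= c)%E.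
Proof.
move=> uc; rewrite limn_einf_lim; apply: lime_le; first exact: is_cvg_einfs.
near=> m; apply: le_trans (uc m _); last by near: m; exact: nbhs_infty_ge.
by apply: ereal_inf_lbound; exists m => //=.
Unshelve. all: by end_near. Qed.

(** Riesz-Fischer, for a geometric rate: the sum of the increments has finite
    expectation, so the sequence converges almost surely, and Fatou's lemma
    identifies the mean-square limit. *)
Lemma L2_complete (f : nat -> T -> R) (C : R) : (forall n, L2 P (f n)) ->
  (forall n m, (n <= m)%N -> nrm P (fun x => f n x - f m x) <= C * (1 / 2) ^+ n) ->
  exists2 I, L2 P I &
    forall n, nrm P (fun x => f n x - I x) <= C * (1 / 2) ^+ n.
Proof.
move=> hf hC.
have C0 : 0 <= C.
  by have := hC 0 0 (leqnn _); rewrite expr0 mulr1; apply: le_trans; exact: nrm_ge0.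
have B0 n : 0 <= C * (1 / 2) ^+ n by rewrite mulr_ge0 // exprn_ge0 // divr_ge0.
pose D k x : R := `|f k.+1 x - f k x|.
have hD k : L2 P (fun x => f k.+1 x - f k x) by exact: L2B.
have mD k : measurable_fun [set: T] (D k).
  by apply: measurableT_comp => //; exact: L2_measurable (hD k).
have ED k : (\int[P]_x (D k x)%:E <= (C * (1 / 2) ^+ k)%:E)%E.
  have hDk : L2 P (D k).
    apply: L2_of_sq => //; rewrite (_ : (fun x => _) = fun x => (f k.+1 x - f k x) ^+ 2).
      by rewrite expectation_sqE // ltry.
    by apply/funext => x; rewrite real_normK // num_real.
  have := ip1E hDk; rewrite unlock => ->; rewrite lee_fin.
  apply: le_trans (ler_norm _) (le_trans (cauchy_schwarz hDk (L2_cst P 1)) _).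
  have -> : nrm P (cst 1) = 1.
    rewrite /nrm /ip (_ : (fun x => _) = cst 1) ?expectation_cst /= ?sqrtr1 //.
    by apply/funext => x; rewrite /= mulr1.
  rewrite mulr1; apply: le_trans (hC k k.+1 (leqnSn k)); rewrite nrmBC.
  rewrite le_eqVlt; apply/orP; left; apply/eqP; rewrite /nrm /ip.
  congr (Num.sqrt (fine 'E_P[_]))%E; apply/funext => x.
  by rewrite -!expr2 real_normK // num_real.
have D0 n x : [set: T] x -> (0 <= (D n x)%:E)%E by move=> _; rewrite lee_fin /D.
have mDE n : measurable_fun [set: T] (EFin \o D n) by exact/measurable_EFinP.
pose S x : \bar R := (\sum_(0 <= k <oo) (D k x)%:E)%E.
have intS : P.-integrable [set: T] S.
  apply/integrableP; split.
    by apply: ge0_emeasurable_sum => [k x _ _|k _]; [exact: D0|exact: mDE].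
  under eq_integral => x _.
    rewrite gee0_abs; last by apply: nneseries_ge0 => *; rewrite lee_fin /D.
    over.
  rewrite integral_nneseries //.
  apply: (@le_lt_trans _ _ (\sum_(0 <= k <oo) (C * (1 / 2) ^+ k)%:E)%E).
    by apply: lee_nneseries => [k _ _|k _]; [apply: integral_ge0 => x; exact: D0|exact: ED].
  have -> : (fun n => \sum_(0 <= k < n) (C * (1 / 2) ^+ k)%:E)%E =
      EFin \o series (geometric C (1 / 2)).
    by apply/funext => n; rewrite /= /series /= -sumEFin.
  have h12 : `|1 / 2 : R| < 1 by rewrite ger0_norm; lra.
  have cg : cvgn (series (geometric C (1 / 2))) by exact: is_cvg_geometric_series.
  by rewrite EFin_lim // ltry.
pose I x := fine (limn_esup (fun n => (f n x)%:E)).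
have mI : measurable_fun [set: T] I.
  apply: measurableT_comp => //; apply: measurable_fun_limn_esup => n.
  by apply/measurable_EFinP; exact: L2_measurable.
have cvgI : {ae P, forall x, f n x @[n --> \oo] --> I x}.
  have := integrable_ae measurableT intS; apply: filterS => x /(_ Logic.I) Sfin.
  have : cvgn (series (telescope (f ^~ x))).
    apply: normed_cvg; apply: nondecreasing_is_cvgn.
      by apply: nondecreasing_series => *; exact: normr_ge0.
    exists (fine (S x)) => _ [n _ <-]; rewrite -lee_fin fineK //.
    rewrite /series /= -sumEFin; apply: nneseries_lim_ge => *; exact: D0.
  rewrite telescopeK => cf.
  have {}cf : cvgn (f ^~ x).
    rewrite (_ : f ^~ x = fun n => (f n x - f 0 x) + f 0 x).
      by apply: is_cvgD => //; exact: is_cvg_cst.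
    by apply/funext => n; rewrite subrK.
  have cfE : (f n x)%:E @[n --> \oo] --> (limn (f ^~ x))%:E by apply: cvg_EFin => //; exact: nearW.
  by rewrite /I (cvg_limn_einf_sup cfE).2.
have Fatou n : ('E_P[fun x => ((f n x - I x) ^+ 2)%R] <= ((C * (1 / 2) ^+ n) ^+ 2)%:E)%E.
  have mn m : measurable_fun [set: T] (EFin \o (fun x => (f n x - f m x) ^+ 2)).
    by apply/measurable_EFinP; apply: measurable_funX; exact: L2_measurable (L2B (hf n) (hf m)).
  have H := @fatou _ _ _ P _ measurableT (fun m => EFin \o (fun x => (f n x - f m x) ^+ 2)) mn.
  rewrite unlock; apply: le_trans; first last.
    apply: (le_trans (H _)) => [m x _|]; first by rewrite lee_fin sqr_ge0.
    apply: (@limn_einf_ub _ _ n) => m nm.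
    have := expectation_sqE (L2B (hf n) (hf m)); rewrite unlock => ->.
    by rewrite lee_fin ler_sqr ?nnegrE ?nrm_ge0 ?B0 ?hC.
  rewrite le_eqVlt; apply/orP; left; apply/eqP; apply: ae_eq_integral => //.
  - apply/measurable_EFinP; apply: measurable_funX; apply: measurable_funB => //.
    exact: L2_measurable.
  - apply: measurableT_comp => //; apply: measurable_fun_limn_esup => m.
    exact: measurableT_comp.
  - apply: filterS cvgI => x cx _; apply/esym.
    have : ((f n x - f m x) ^+ 2)%:E @[m --> \oo] --> ((f n x - I x) ^+ 2)%:E.
      apply: cvg_EFin; first exact: nearW.
      by rewrite /comp /=; under eq_fun do rewrite expr2; rewrite expr2;
        apply: cvgM; apply: cvgB => //; exact: cvg_cst.
    by move/cvg_limn_einf_sup => [].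
have hI n : L2 P (fun x => f n x - I x).
  apply: L2_of_sq; last exact: le_lt_trans (Fatou n) (ltry _).
  by apply: measurable_funB => //; exact: L2_measurable.
exists I => [|n].
  have := L2B (hf 0%N) (hI 0%N); congr (L2 P _); apply/funext => x; ring.
have := Fatou n; rewrite expectation_sqE // lee_fin.
by rewrite ler_sqr ?nnegrE ?nrm_ge0 ?B0.
Qed.

End Completeness.

(** * Finite differences and interpolation on grids *)
Section FiniteDifferences.
Context {R : realFieldType}.
Implicit Types (d : nat) (iota c s t : R) (f g : R -> R) (p : {poly R}).

(** Written termwise like the differences of a process, so that the two agree
    by computation. *)
Definition fdiff d iota f t : R :=
  \sum_(k < d.+1) (-1) ^+ k * 'C(d, k)%:R * f (t - k%:R * iota).

Lemma fdiffS d iota f t :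
  fdiff d.+1 iota f t = fdiff d iota (fun u => f u - f (u - iota)) t.
Proof.
rewrite /fdiff big_ord_recl /= bin0 expr0 !mul1r mul0r subr0.
under eq_bigr => i _.
  rewrite /bump /= add1n binS natrD exprS mulN1r.
  rewrite mulrDr mulrDl.
  over.
rewrite big_split /= big_ord_recr /= bin_small // mulr0 mul0r addr0 addrA.
under [RHS]eq_bigr do rewrite mulrBr.
rewrite sumrB; congr (_ + _).
  rewrite [RHS]big_ord_recl /= bin0 expr0 !mul1r mul0r subr0; congr (_ + _).
  by apply: eq_bigr => i _; rewrite /bump /= add1n exprS mulN1r.
rewrite -sumrN; apply: eq_bigr => i _.
rewrite !mulNr; congr (- (_ * f _)).
by rewrite -natr1; ring.
Qed.

Lemma fdiffZ d iota f (a : R) t :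
  fdiff d iota (fun u => a * f u) t = a * fdiff d iota f t.
Proof. by rewrite mulr_sumr; apply: eq_bigr => i _; rewrite mulrCA. Qed.

Lemma fdiffB d iota f g t :
  fdiff d iota (fun u => f u - g u) t = fdiff d iota f t - fdiff d iota g t.
Proof. by rewrite -sumrB /=; apply: eq_bigr => i _; rewrite mulrBr. Qed.

Lemma fdiff_sum d iota n (F : 'I_n -> R -> R) t :
  fdiff d iota (fun u => \sum_i F i u) t = \sum_i fdiff d iota (F i) t.
Proof.
by rewrite exchange_big /=; apply: eq_bigr => i _; rewrite mulr_sumr.
Qed.

(** A translation preserves the leading coefficient. *)
Lemma size_diff_comp p iota : (size (p - (p \Po ('X - iota%:P)))%R <= (size p).-1)%N.
Proof.
pose q := p \Po ('X - iota%:P); rewrite -/q.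
have sq : size q = size p by rewrite size_comp_poly2 // size_XsubC.
have sp : (size (p - q)%R <= size p)%N.
  by rewrite (leq_trans (size_polyD _ _)) // size_polyN sq maxnn.
apply/leq_sizeP => j; rewrite leq_eqVlt => /predU1P[<-|lj]; last first.
  by apply: nth_default; apply: leq_trans sp (leq_trans (leqSpred _) lj).
rewrite coefB -{2}sq -!lead_coefE /q lead_coef_comp ?size_XsubC //.
by rewrite lead_coefXsubC expr1n mulr1 subrr.
Qed.

Lemma fdiff_poly d iota p t : (size p <= d)%N -> fdiff d iota (horner p) t = 0.
Proof.
elim: d p => [|d IHd] p sp.
  by move: sp; rewrite size_poly_leq0 => /eqP ->; rewrite /fdiff big_ord1 horner0 mulr0.
rewrite fdiffS -(IHd (p - (p \Po ('X - iota%:P)))).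
  by apply: eq_bigr => i _; rewrite !hornerE horner_comp !hornerE.
by rewrite (leq_trans (size_diff_comp _ _)) //; case: (size p) sp.
Qed.

(** On a grid the equation is a recurrence of order [d] with invertible extreme
    coefficients, so a solution is determined by [d] consecutive values. *)
Lemma fdiff_grid_eq0 d iota c f :
  (forall t, fdiff d iota f t = 0) ->
  (forall m, (m < d)%N -> f (c + m%:R * iota) = 0) ->
  forall m, f (c + m%:R * iota) = 0.
Proof.
move=> fd f0; elim/ltn_ind => m IH; have [/f0//|dm] := ltnP m d.
have := fd (c + m%:R * iota).
rewrite /fdiff big_ord_recl /= bin0 expr0 !mul1r mul0r subr0 big1 ?addr0 // => i _.
have -> : c + m%:R * iota - (bump 0 i)%:R * iota = c + (m - i.+1)%:R * iota.
  rewrite /bump /= add1n natrB ?(leq_trans _ dm) //; ring.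
by rewrite IH ?mulr0 // ltn_subrL /= (leq_trans _ dm) // (leq_ltn_trans _ (ltn_ord i)).
Qed.

(** The polynomial interpolating [f] at [d] consecutive grid points solves the same
    recurrence, so it coincides with [f] on the rest of the grid. *)
Lemma fdiff_grid_poly d iota c f : (0 < d)%N -> iota != 0 ->
  (forall t, fdiff d iota f t = 0) ->
  exists2 p : {poly R}, (size p <= d)%N &
    forall m, f (c + m%:R * iota) = p.[c + m%:R * iota].
Proof.
move=> d0 i0 fd; pose x (m : nat) := c + m%:R * iota.
have xI : injective x.
  by move=> m n /addrI /(mulIf i0) /eqP; rewrite eqr_nat => /eqP.
pose p : {poly R} := \sum_(j < d) (f (x j))%:P * tnth (@lagrange R d x) j.
have sp : (size p <= d)%N.
  rewrite (leq_trans (size_sum _ _ _)) //; apply/bigmax_leqP => j _.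
  rewrite mul_polyC (leq_trans (size_scale_leq _ _)) // size_lagrange_.
exists p => // m; apply/eqP; rewrite -subr_eq0; apply/eqP.
apply: (@fdiff_grid_eq0 d iota c (fun u => f u - p.[u])) => [t|{}m md].
  by rewrite fdiffB fd fdiff_poly // subrr.
rewrite horner_sum (bigD1 (Ordinal md)) //= big1 ?addr0 => [|j jm].
  by rewrite !hornerE (lagrange_sample d0 xI (Ordinal md) (Ordinal md)) eqxx mulr1 subrr.
rewrite !hornerE (lagrange_sample d0 xI j (Ordinal md)) (negbTE jm).
exact: mulr0.
Qed.

Lemma natr_inj : injective (fun i : nat => i%:R : R).
Proof. by move=> m n /eqP; rewrite eqr_nat => /eqP. Qed.

(** The Lagrange basis at the nodes [0, ..., d - 1]. These nodes lie on every grid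
    of step [1 / n], which makes the interpolant independent of the grid. *)
Definition node_basis d (j : 'I_d) : {poly R} :=
  tnth (@lagrange R d (fun i : nat => i%:R)) j.

Lemma size_node_basis d (j : 'I_d) : (size (node_basis j) <= d)%N.
Proof.
have d0 : (0 < d)%N := leq_ltn_trans (leq0n j) (ltn_ord j).
by rewrite (size_lagrange_ d0 natr_inj).
Qed.

(** [f] is polynomial on the grid of step [1 / (n + 1)]; that grid contains the
    nodes [0, ..., d - 1], and the values there determine the polynomial. *)
Lemma fdiff_interpolation d n N m f : (0 < d)%N ->
  (forall t, fdiff d n.+1%:R^-1 f t = 0) ->
  let s := - N%:R + m%:R * n.+1%:R^-1 in
  f s = \sum_(j < d) f j%:R * (node_basis j).[s].
Proof.
move=> d0 fd s.
have n0 : (n.+1%:R^-1 : R) != 0 by rewrite invr_eq0 pnatr_eq0.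
have [p sp fp] := fdiff_grid_poly (- N%:R) d0 n0 fd.
have fj (j : nat) : f j%:R = p.[j%:R].
  have -> : j%:R = - N%:R + ((N + j) * n.+1)%:R * n.+1%:R^-1 :> R.
    by rewrite natrM mulfK ?pnatr_eq0 // natrD addKr.
  exact: fp.
rewrite fp (lagrange_gen d0 natr_inj sp) horner_sum.
apply: eq_bigr => j _; rewrite hornerM hornerC; congr (_ * _).
by rewrite fj.
Qed.

(** The two variables are interpolated one after the other: for frozen [t], the
    [t]-difference of [D] is a solution in [s]; so the interpolation error in [s]
    is, for [s] on the grid, a solution in [t]. Both steps use the same mesh. *)
Lemma fdiff2_interpolation d n N m1 m2 (D : R -> R -> R) : (0 < d)%N ->
  (forall s t, fdiff d n.+1%:R^-1 (fun u => fdiff d n.+1%:R^-1 (D u) t) s = 0) ->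
  let s := - N%:R + m1%:R * n.+1%:R^-1 in
  let t := - N%:R + m2%:R * n.+1%:R^-1 in
  D s t = \sum_(j < d) (node_basis j).[s] * D j%:R t +
    \sum_(k < d) (node_basis k).[t] *
      (D s k%:R - \sum_(j < d) (node_basis j).[s] * D j%:R k%:R).
Proof.
move=> d0 DD s t.
have H u : fdiff d n.+1%:R^-1
    (fun t => D s t - \sum_(j < d) (node_basis j).[s] * D j%:R t) u = 0.
  have /= E := @fdiff_interpolation d n N m1 (fun v => fdiff d n.+1%:R^-1 (D v) u)
    d0 (fun v => DD v u).
  rewrite fdiffB E fdiff_sum -sumrB big1 // => j _.
  by rewrite fdiffZ mulrC subrr.
apply/eqP; rewrite addrC -subr_eq; apply/eqP.
rewrite (fdiff_interpolation N m2 d0 H).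
by apply: eq_bigr => k _; rewrite mulrC.
Qed.

End FiniteDifferences.

(** * Riemann sums over tagged partitions *)
Section TaggedPartitions.
Context {R : realType}.
Implicit Types (a b u v delta : R) (s : seq (R * R)).

(** The list holds the pairs of a division point and the tag of the subinterval
    that ends there; the starting point [u] is kept apart, which allows proofs by
    induction on the list. *)
Fixpoint tagged_partition delta u b s : Prop :=
  if s is (v, tau) :: s' then
    [/\ u < v, v - u < delta, u <= tau <= v & tagged_partition delta v b s']
  else u = b.

Fixpoint tagged_sum {V : nmodType} (Phi : R -> R -> R -> V) u s : V :=
  if s is (v, tau) :: s' then Phi tau u v + tagged_sum Phi v s' else 0.

Lemma tagged_partition_exists delta a b : 0 < delta -> a <= b ->
  exists s, tagged_partition delta a b s.
Proof.
move=> d0 ab.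
have [n] : exists n : nat, b - a < n%:R * (delta / 2).
  exists (Num.truncn ((b - a) / (delta / 2))).+1.
  by rewrite -ltr_pdivrMr ?divr_gt0 // truncnS_gt.
elim: n a ab => [|n IH] a ab; first by rewrite mul0r; lra.
move=> abn; have [bad|dba] := ltP (b - a) delta.
  have [->|an] := eqVneq a b; first by exists [::].
  exists [:: (b, b)] => /=; split => //; first by rewrite lt_neqAle an.
  by rewrite lexx andbT.
have [||s hs] := IH (a + delta / 2); [lra|move: abn; rewrite -natr1; lra|].
exists ((a + delta / 2, a) :: s) => /=; split => //; [lra|lra|].
by apply/andP; split; lra.
Qed.

Lemma tagged_partition_le delta a b s : tagged_partition delta a b s -> a <= b.
Proof.
elim: s a => [|[v t] s IH] a /=; first by move=> ->.
by case=> av _ _ /IH vb; rewrite (le_trans (ltW av)).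
Qed.

Lemma tagged_partitionW delta delta' a b s : delta <= delta' ->
  tagged_partition delta a b s -> tagged_partition delta' a b s.
Proof.
move=> dd; elim: s a => [//|[v t] s IH] a /= [av vad at_ /IH H]; split => //.
exact: lt_le_trans dd.
Qed.

Lemma tagged_partition_shift delta a b h s : tagged_partition delta a b s ->
  tagged_partition delta (a + h) (b + h) [seq (p.1 + h, p.2 + h) | p <- s].
Proof.
elim: s a => [|[v t] s IH] a /=; first by move=> ->.
case=> av vad at_ /IH H; split => //; rewrite ?ltrD2r ?lerD2r //.
by rewrite opprD addrACA subrr addr0.
Qed.

Lemma tagged_sum_shift (V : nmodType) (Phi : R -> R -> R -> V) a h s :
  tagged_sum Phi (a + h) [seq (p.1 + h, p.2 + h) | p <- s] =
  tagged_sum (fun t u v => Phi (t + h) (u + h) (v + h)) a s.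
Proof. by elim: s a => [//|[v t] s IH] a /=; rewrite IH. Qed.

Lemma sum_tagged_sum (V : nmodType) (Phi : R -> R -> R -> V) a b s :
  \sum_(i < size s) Phi (nth 0 (unzip2 s) i) (nth b (a :: unzip1 s) i)
    (nth b (a :: unzip1 s) i.+1) = tagged_sum Phi a s.
Proof.
elim: s a => [|[v t] s IH] a /=; first by rewrite big_ord0.
by rewrite big_ord_recl /= -IH.
Qed.

Lemma tagged_partitionP delta a b s : tagged_partition delta a b s <->
  itv_partition a b (unzip1 s) /\
  forall i, (i < size (unzip1 s))%N ->
    nth b (a :: unzip1 s) i <= nth 0 (unzip2 s) i <= nth b (a :: unzip1 s) i.+1 /\
    nth b (a :: unzip1 s) i.+1 - nth b (a :: unzip1 s) i < delta.
Proof.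
elim: s a => [|[v t] s IH] a /=.
  by split=> [->|[[_ /eqP]] //]; split => //; split => //=.
split=> [[av vad avt /IH [[pvs lvs] H]]|[[/= /andP[av pvs] lvs] H]].
  by split=> [|[|i] /= i_s]; [split => //=; rewrite av| |exact: H].
split=> //; [by have [] := H 0%N|by have [] := H 0%N|].
by apply/IH; split=> // i i_s; exact: (H i.+1).
Qed.

End TaggedPartitions.

Section MeanSquareIntegral.
Context (disp : measure_display) (T : measurableType disp) (R : realType).
Variable P : probability T R.

(** The recursion over the tagged partition replaces the indexing by positions. *)
Lemma ms_integralP (Phi : R -> R -> R -> T -> R[i]) (a b : R) (I : T -> R[i]) :
  ms_integral P Phi a b I <-> L2C P I /\
  forall eps : R, 0 < eps -> exists2 delta : R, 0 < delta &
    forall s, tagged_partition delta a b s ->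
      (ms_sqdist P (fun x => tagged_sum (fun t u v => Phi t u v x) a s) I <= eps%:E)%E.
Proof.
split=> -[hI H]; split=> // eps /H [delta d0 {}H]; exists delta => //.
  move=> s /tagged_partitionP [p1 p2].
  have := H (unzip1 s) (nth 0 (unzip2 s)) p1 p2.
  congr (ms_sqdist P _ _ <= _)%E; apply/funext => x.
  by rewrite -(sum_tagged_sum _ _ b) size_map.
move=> s tag p1 p2.
pose s' := zip s (mkseq tag (size s)).
have s1 : unzip1 s' = s by rewrite unzip1_zip // size_mkseq.
have s2 : unzip2 s' = mkseq tag (size s) by rewrite unzip2_zip // size_mkseq.
have ss : size s' = size s by rewrite -s1 size_map.
have ts' : tagged_partition delta a b s'.
  apply/tagged_partitionP; rewrite s1 s2; split => // i i_s.
  by rewrite nth_mkseq //; exact: p2.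
have := H _ ts'.
congr (ms_sqdist P _ _ <= _)%E; apply/funext => x.
rewrite -(sum_tagged_sum _ _ b) s1 s2 ss; apply: eq_bigr => i _.
by rewrite nth_mkseq.
Qed.

End MeanSquareIntegral.

(** * Locally Lipschitz functions *)
Section LocallyLipschitz.
Context {R : realType}.
Implicit Types (f g : R -> R) (s t M L : R).

Lemma itv_norm_bound (a b t : R) : a <= t <= b -> `|t| <= `|a| + `|b|.
Proof.
move=> /andP[at_ tb]; rewrite ler_norml.
have := ler_norm b; have := ler_norm (- a); rewrite normrN => na nb.
have := normr_ge0 a; have := normr_ge0 b => b0 a0.
by apply/andP; split; lra.
Qed.

(** A class of continuous functions that contains the polynomials, is stable under
    the operations needed below, and has explicit moduli for Riemann sums. *)
Definition locally_lipschitz g := forall M, exists2 L, 0 <= L &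
  forall s t, `|s| <= M -> `|t| <= M -> `|g t - g s| <= L * `|t - s|.

Lemma loclip_cst c : locally_lipschitz (fun=> c).
Proof. by move=> M; exists 0 => // s t _ _; rewrite subrr normr0 mul0r. Qed.

Lemma loclip_id : locally_lipschitz id.
Proof. by move=> M; exists 1 => // s t _ _; rewrite mul1r. Qed.

Lemma loclipD f g : locally_lipschitz f -> locally_lipschitz g ->
  locally_lipschitz (fun t => f t + g t).
Proof.
move=> hf hg M; have [L L0 hL] := hf M; have [K K0 hK] := hg M.
exists (L + K) => [|s t sM tM]; first exact: addr_ge0.
rewrite opprD addrACA mulrDl (le_trans (ler_normD _ _)) // lerD ?hL ?hK //.
Qed.

Lemma loclip_bounded g M : locally_lipschitz g -> exists2 B, 0 <= B &
  forall t, `|t| <= M -> `|g t| <= B.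
Proof.
move=> /(_ (Num.max M 0)) [L L0 hL].
exists (L * Num.max M 0 + `|g 0|) => [|t tM].
  by rewrite addr_ge0 // mulr_ge0 // le_max lexx orbT.
have tM' : `|t| <= Num.max M 0 by rewrite le_max tM.
rewrite -[g t](subrK (g 0)) (le_trans (ler_normD _ _)) // lerD2r.
apply: le_trans (hL 0 t _ tM') _; first by rewrite normr0 le_max lexx orbT.
by rewrite subr0 ler_wpM2l.
Qed.

Lemma loclipM f g : locally_lipschitz f -> locally_lipschitz g ->
  locally_lipschitz (fun t => f t * g t).
Proof.
move=> hf hg M; have [L L0 hL] := hf M; have [K K0 hK] := hg M.
have [A A0 hA] := loclip_bounded M hf; have [B B0 hB] := loclip_bounded M hg.
exists (A * K + L * B) => [|s t sM tM]; first by rewrite addr_ge0 // mulr_ge0.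
have -> : f t * g t - f s * g s = f t * (g t - g s) + (f t - f s) * g s by ring.
rewrite (le_trans (ler_normD _ _)) // !normrM mulrDl lerD //.
  by rewrite -mulrA ler_pM ?hA ?hK.
by rewrite mulrAC ler_pM ?hL ?hB.
Qed.

Lemma loclipZ c g : locally_lipschitz g -> locally_lipschitz (fun t => c * g t).
Proof. by move=> hg; apply: loclipM => //; exact: loclip_cst. Qed.

Lemma loclipB f g : locally_lipschitz f -> locally_lipschitz g ->
  locally_lipschitz (fun t => f t - g t).
Proof.
move=> hf hg; rewrite (_ : (fun t => _) = fun t => f t + -1 * g t).
  by apply: loclipD => //; exact: loclipZ.
by apply/funext => t; rewrite mulN1r.
Qed.

Lemma loclip_sum n (F : 'I_n -> R -> R) : (forall i, locally_lipschitz (F i)) ->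
  locally_lipschitz (fun t => \sum_i F i t).
Proof.
move=> hF; elim: n F hF => [|n IH] F hF.
  by under eq_fun do rewrite big_ord0; exact: loclip_cst.
under eq_fun do rewrite big_ord_recr /=.
by apply: loclipD; [exact: IH|exact: hF].
Qed.

Lemma loclip_poly (p : {poly R}) : locally_lipschitz (horner p).
Proof.
elim/poly_ind: p => [|p c IH].
  rewrite (_ : horner 0 = fun=> 0); first exact: loclip_cst.
  by apply/funext => t; rewrite horner0.
rewrite (_ : horner _ = fun t => p.[t] * t + c); last first.
  by apply/funext => t; rewrite hornerMXaddC.
apply: loclipD; last exact: loclip_cst.
by apply: loclipM => //; exact: loclip_id.
Qed.

Lemma loclip_shift g h : locally_lipschitz g -> locally_lipschitz (fun t => g (t + h)).
Proof.
move=> hg M; have [L L0 hL] := hg (M + `|h|); exists L => // s t sM tM.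
have -> : t - s = (t + h) - (s + h) by ring.
by apply: hL; rewrite (le_trans (ler_normD _ _)) // lerD.
Qed.

Lemma loclip_continuous g : locally_lipschitz g -> continuous g.
Proof.
move=> hg t; apply/cvgrPdist_le => e e0.
have [L L0 hL] := hg (`|t| + 1).
near=> s.
have st : `|t - s| <= e / (L + 1).
  by near: s; apply: cvgr_dist_le; [exact: cvg_id|rewrite divr_gt0 // ltr_wpDl].
have st1 : `|t - s| <= 1 by near: s; apply: cvgr_dist_le; [exact: cvg_id|].
have sM : `|s| <= `|t| + 1.
  have -> : s = t - (t - s) by ring.
  by rewrite (le_trans (ler_normB _ _)) // lerD2l.
have tM : `|t| <= `|t| + 1 by rewrite lerDl.
apply: le_trans (hL s t sM tM) _.
apply: (@le_trans _ _ ((L + 1) * (e / (L + 1)))); first by rewrite ler_pM // lerDl.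
by rewrite mulrC divfK // gt_eqF // ltr_wpDl.
Unshelve. all: by end_near. Qed.

(** The grids of step [1 / (n + 1)] are dense. *)
Lemma loclip_grid_eq f g : locally_lipschitz f -> locally_lipschitz g ->
  (forall N m n : nat, f (- N%:R + m%:R * n.+1%:R^-1) = g (- N%:R + m%:R * n.+1%:R^-1)) ->
  f =1 g.
Proof.
move=> hf hg fg t; apply/eqP; rewrite -subr_eq0; apply/negPn/negP => n0.
have [L L0 hL] := loclipB hf hg (`|t| + 1).
(* A grid point [s] closer to [t] than [e] cannot be a zero of [f - g]. *)
set e := `|f t - g t| / (L + 1).
have e0 : 0 < e by rewrite divr_gt0 ?normr_gt0 // ltr_wpDl.
(* The step is below [e], and the grid starts to the left of [t]. *)
pose n := Num.truncn (e^-1); pose N := (Num.truncn `|t|).+1.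
pose h : R := n.+1%:R^-1.
have h0 : 0 < h by rewrite invr_gt0.
have he : h < e by rewrite invf_plt // ?posrE // truncnS_gt.
have h1 : h <= 1 by rewrite invf_le1 // ler1n.
have Nt : 0 <= t + N%:R.
  have : `|t| < N%:R by rewrite truncnS_gt.
  by have := ler_norm (- t); rewrite normrN; lra.
pose m := Num.truncn ((t + N%:R) / h).
pose s := - N%:R + m%:R * h.
have ms : `|t - s| <= h.
  have /truncn_itv : 0 <= (t + N%:R) / h by rewrite divr_ge0 // ltW.
  rewrite -/m ler_pdivlMr // ltr_pdivrMr // => /andP[ms1 ms2].
  have -> : t - s = t + N%:R - m%:R * h by rewrite /s; ring.
  by move: ms2; rewrite -(natr1 m) mulrDl mul1r => ms2; rewrite ger0_norm; lra.
have sM : `|s| <= `|t| + 1.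
  have -> : s = t - (t - s) by ring.
  by rewrite (le_trans (ler_normB _ _)) // lerD2l (le_trans ms).
have tM : `|t| <= `|t| + 1 by rewrite lerDl.
have := hL s t sM tM; rewrite (fg N m n : f s = g s) subrr subr0.
apply/negP; rewrite -ltNge.
apply: (@le_lt_trans _ _ ((L + 1) * h)); first by rewrite ler_pM // lerDl.
by rewrite mulrC -ltr_pdivlMr // ltr_wpDl.
Qed.

End LocallyLipschitz.

(** * Integrals of locally Lipschitz functions against signed measures *)
Section ChargeIntegral.
Context {R : realType}.
Implicit Types (a b : R) (f g : R -> R) (lam : {charge set (measurableTypeR R) -> \bar R}).

Section FiniteMeasure.
Variable mu : {finite_measure set (measurableTypeR R) -> \bar R}.

Lemma integrable_loclip a b g : locally_lipschitz g ->
  mu.-integrable (`]a, b]%classic : set (measurableTypeR R)) (EFin \o g).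
Proof.
move=> hg; apply: measurable_bounded_integrable => //.
- by rewrite ltey_eq fin_num_measure.
- apply: (@measurable_funS _ _ _ _ setT) => //.
  by apply: continuous_measurable_fun; exact: loclip_continuous.
- have [B B0 hB] := loclip_bounded (`|a| + `|b|) hg.
  exists B; split; first exact: num_real.
  move=> C BC x /=; rewrite in_itv /= => /andP[ax xb].
  by apply: le_trans (hB x _) (ltW BC); apply: itv_norm_bound; rewrite (ltW ax).
Qed.

(** On a subinterval of length below [delta] the integrand differs from its value
    at the tag by at most [L * delta]; the errors add up to [L * delta] times the
    total mass. *)
Lemma riemann_sum_measure a b g L delta s : 0 <= L -> locally_lipschitz g ->
  (forall u v, a <= u <= b -> a <= v <= b -> `|g v - g u| <= L * `|v - u|) ->
  tagged_partition delta a b s ->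
  `|tagged_sum (fun t u v => g t * fine (mu `]u, v]%classic)) a s -
    (\int[mu]_(x in `]a, b]%classic) g x)%R| <= L * delta * fine (mu `]a, b]%classic).
Proof.
move=> L0 hg; elim: s a => [|[v t] s IH] a /= hL.
  by move=> ->; rewrite set_itvoc0 Rintegral_set0 subrr normr0 measure0 mulr0.
case=> av vad /andP[at_ tv] ts.
have vb := tagged_partition_le ts.
have {}IH := IH v _ ts.
have Dab : `]a, b]%classic = `]a, v]%classic `|` `]v, b]%classic :> set R.
  by rewrite -itv_bndbnd_setU // bnd_simp ltW.
have dis : [disjoint (`]a, v]%classic : set R) & `]v, b]%classic].
  apply/disj_setPS => x /= [] /[!in_itv] /= /andP[_ xv] /andP[vx _].
  by move: vx; rewrite ltNge xv.
rewrite Dab Rintegral_setU //; last first.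
  by rewrite -Dab; exact: integrable_loclip.
rewrite measureU //; last exact/disj_set2P.
rewrite fineD ?fin_num_measure // mulrDr opprD addrACA.
apply: le_trans (ler_normD _ _) _; apply: lerD; last first.
  apply: IH => u w /andP[vu ub] /andP[vw wb].
  by apply: hL; rewrite ?ub ?wb andbT (le_trans (ltW av)).
rewrite -Rintegral_cst // -RintegralB //; last exact: integrable_loclip.
  apply: le_trans (le_normr_Rintegral _ _) _ => //.
    have := @integrable_loclip a v _ (loclipB (loclip_cst (g t)) hg); exact.
  rewrite -Rintegral_cst //; apply: le_Rintegral => //.
  - apply: (@integrable_loclip a v (fun x => `|g t - g x|)).
    move=> M; have [K K0 hK] := loclipB (loclip_cst (g t)) hg M.
    by exists K => // x y xM yM; apply: le_trans (ler_dist_dist _ _) (hK _ _ xM yM).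
  - have := @integrable_loclip a v _ (loclip_cst (L * delta)); exact.
  - move=> x /=; rewrite in_itv /= => /andP[ax xv].
    apply: le_trans (hL x t _ _) _; [lra|lra|].
    by rewrite ler_wpM2l // ler_norml; lra.
by have := @integrable_loclip a v _ (loclip_cst (g t)); exact.
Qed.

End FiniteMeasure.

End ChargeIntegral.
Section ChargeIntegralTheory.
Context {R : realType}.
Implicit Types (a b : R) (f g : R -> R) (lam : {charge set (measurableTypeR R) -> \bar R}).

(** The Jordan parts for the Hahn decomposition chosen in [charge_integral]. *)
Definition cpos lam : {finite_measure set (measurableTypeR R) -> \bar R} :=
  jordan_pos (projT2 (cid (projT2 (cid (Hahn_decomposition lam))))).

Definition cneg lam : {finite_measure set (measurableTypeR R) -> \bar R} :=
  jordan_neg (projT2 (cid (projT2 (cid (Hahn_decomposition lam))))).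

Definition cint lam g : R := fine (charge_integral lam g).

Definition total_mass lam : R := fine (cpos lam setT) + fine (cneg lam setT).

Lemma total_mass_ge0 lam : 0 <= total_mass lam.
Proof. by rewrite addr_ge0 // fine_ge0. Qed.

Lemma cposB lam (A : set (measurableTypeR R)) : measurable A ->
  fine (lam A) = fine (cpos lam A) - fine (cneg lam A).
Proof.
move=> mA; have := jordan_decomp (projT2 (cid (projT2 (cid (Hahn_decomposition lam))))) mA.
rewrite /cadd /= cscaleN1 => ->.
rewrite fineB //; [exact: (fin_num_measure (cpos lam))|exact: (fin_num_measure (cneg lam))].
Qed.

(** The positive part of [A] is the charge of the intersection of [A] with the
    positive set, a set which still avoids [D]. *)
Lemma concentrated_cpos lam (D A : set (measurableTypeR R)) :
  concentrated lam D -> measurable A ->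
  A `&` D = set0 -> cpos lam A = 0%E.
Proof.
move=> lD mA AD.
have := projT2 (cid (projT2 (cid (Hahn_decomposition lam)))) => -[[mP _] _ _ _].
rewrite -[LHS]/(jordan_pos (projT2 (cid (projT2 (cid (Hahn_decomposition lam))))) A).
rewrite jordan_posE cjordan_posE /crestr0 mem_set // /crestr.
by apply: lD; [exact: measurableI|rewrite setIAC AD set0I].
Qed.

Lemma concentrated_cneg lam (D A : set (measurableTypeR R)) :
  concentrated lam D -> measurable A ->
  A `&` D = set0 -> cneg lam A = 0%E.
Proof.
move=> lD mA AD.
have := projT2 (cid (projT2 (cid (Hahn_decomposition lam)))) => -[_ [mN _] _ _].
rewrite -[LHS]/(jordan_neg (projT2 (cid (projT2 (cid (Hahn_decomposition lam))))) A).
rewrite jordan_negE cjordan_negE /crestr0 mem_set // /crestr.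
by rewrite lD ?oppe0 //; [exact: measurableI|rewrite setIAC AD set0I].
Qed.

Lemma integral_concentrated (mu : {finite_measure set (measurableTypeR R) -> \bar R}) a b g :
  locally_lipschitz g -> mu (~` `]a, b]%classic) = 0%E ->
  (\int[mu]_x (g x)%:E = (\int[mu]_(x in `]a, b]%classic) g x)%:E)%E.
Proof.
move=> hg mu0.
have mN : measurable (~` `]a, b]%classic : set (measurableTypeR R)) by exact: measurableC.
have mg : measurable_fun [set: measurableTypeR R] (EFin \o g).
  by apply/measurable_EFinP; apply: continuous_measurable_fun; exact: loclip_continuous.
have E : setT `\` (~` `]a, b]%classic) = `]a, b]%classic :> set (measurableTypeR R).
  by rewrite setTD setCK.
have ig := integrable_loclip mu a b hg.
rewrite (@negligible_integral _ _ _ mu setT (~` `]a, b]%classic)) //.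
  rewrite E /Rintegral fineK //; exact: integrable_fin_num.
by apply/(negligible_integrable mN measurableT mg mu0); rewrite E.
Qed.

Lemma cintE lam a b g : concentrated lam `]a, b]%classic -> locally_lipschitz g ->
  charge_integral lam g = ((\int[cpos lam]_(x in `]a, b]%classic) g x)%R -
    (\int[cneg lam]_(x in `]a, b]%classic) g x)%R)%:E.
Proof.
move=> lD hg; have mD : measurable (`]a, b]%classic : set (measurableTypeR R)) by [].
rewrite /charge_integral EFinB; congr (_ - _)%E.
  apply: (@integral_concentrated (cpos lam)) => //.
  by apply: concentrated_cpos lD _ _; [exact: measurableC|exact: setICl].
apply: (@integral_concentrated (cneg lam)) => //.
by apply: concentrated_cneg lD _ _; [exact: measurableC|exact: setICl].
Qed.

Lemma cint_charge_integral lam a b g : concentrated lam `]a, b]%classic -> locally_lipschitz g ->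
  charge_integral lam g = (cint lam g)%:E.
Proof. by move=> lD hg; rewrite /cint (cintE lD hg). Qed.

Lemma cintD lam a b f g : concentrated lam `]a, b]%classic ->
  locally_lipschitz f -> locally_lipschitz g ->
  cint lam (fun t => f t + g t) = cint lam f + cint lam g.
Proof.
move=> lD hf hg; rewrite /cint !(cintE lD) //=; last exact: loclipD.
rewrite !RintegralD //; try exact: integrable_loclip.
by rewrite opprD addrACA.
Qed.

Lemma cintZ lam a b c g : concentrated lam `]a, b]%classic -> locally_lipschitz g ->
  cint lam (fun t => c * g t) = c * cint lam g.
Proof.
move=> lD hg; rewrite /cint !(cintE lD) //=; last exact: loclipZ.
rewrite !RintegralZl //; try exact: integrable_loclip.
by rewrite mulrBr.
Qed.

Lemma cint0 lam : cint lam (fun=> 0) = 0.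
Proof. by rewrite /cint /charge_integral !integral0 sube0. Qed.

Lemma cintB lam a b f g : concentrated lam `]a, b]%classic ->
  locally_lipschitz f -> locally_lipschitz g ->
  cint lam (fun t => f t - g t) = cint lam f - cint lam g.
Proof.
move=> lD hf hg; rewrite -mulN1r -(cintZ _ lD hg) -(cintD lD hf); last exact: loclipZ.
by congr cint; apply/funext => t; rewrite mulN1r.
Qed.

Lemma cint_sum lam a b n (F : 'I_n -> R -> R) : concentrated lam `]a, b]%classic ->
  (forall i, locally_lipschitz (F i)) -> cint lam (fun t => \sum_i F i t) = \sum_i cint lam (F i).
Proof.
move=> lD hF; elim: n F hF => [|n IH] F hF.
  by rewrite big_ord0 -[RHS](cint0 lam); congr cint; apply/funext => t; rewrite big_ord0.
rewrite big_ord_recr /= -IH // -(cintD lD) //; last exact: loclip_sum.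
by congr cint; apply/funext => t; rewrite big_ord_recr.
Qed.

Lemma tagged_sumB (V : zmodType) (Phi Psi : R -> R -> R -> V) u s :
  tagged_sum (fun t u v => Phi t u v - Psi t u v) u s = tagged_sum Phi u s - tagged_sum Psi u s.
Proof.
by elim: s u => [|[v t] s IH] u /=; rewrite ?subr0 // IH opprD addrACA.
Qed.

(** The estimate for measures, applied to both Jordan parts. *)
Lemma riemann_sum_charge lam a b g L delta s : concentrated lam `]a, b]%classic ->
  0 <= L -> 0 <= delta -> locally_lipschitz g ->
  (forall u v, a <= u <= b -> a <= v <= b -> `|g v - g u| <= L * `|v - u|) ->
  tagged_partition delta a b s ->
  `|tagged_sum (fun t u v => g t * fine (lam `]u, v]%classic)) a s - cint lam g|
    <= L * delta * total_mass lam.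
Proof.
move=> lD L0 d0 hg hL ts.
rewrite (_ : (fun t u v => _) = (fun t u v => g t * fine (cpos lam `]u, v]%classic) -
    g t * fine (cneg lam `]u, v]%classic))); last first.
  by apply/funext => t; apply/funext => u; apply/funext => v; rewrite cposB // mulrBr.
rewrite tagged_sumB /cint (cintE lD hg) /=.
set A := tagged_sum _ _ _; set B := tagged_sum _ _ _.
set C := (\int[_]_(x in _) _)%R; set D := (\int[_]_(x in _) _)%R.
have -> : A - B - (C - D) = (A - C) - (B - D) by ring.
apply: le_trans (ler_normB _ _) _; rewrite mulrDr lerD //.
  apply: le_trans (riemann_sum_measure _ L0 hg hL ts) _.
  rewrite ler_wpM2l ?mulr_ge0 // fine_le ?fin_num_measure //.
  by rewrite le_measure // inE.
apply: le_trans (riemann_sum_measure _ L0 hg hL ts) _.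
rewrite ler_wpM2l ?mulr_ge0 // fine_le ?fin_num_measure //.
by rewrite le_measure // inE.
Qed.

End ChargeIntegralTheory.

(** * The integral of a process against a signed measure *)
Section ProcessIntegral.
Local Open Scope complex_scope.
Context (disp : measure_display) (T : measurableType disp) (R : realType).
Variable P : probability T R.
Implicit Types (X : R -> T -> R) (lam : {charge set (measurableTypeR R) -> \bar R}).
Implicit Types (U V I J : T -> R).

Local Notation L2 := (L2 P).
Local Notation ip := (ip P).
Local Notation nrm := (nrm P).

(** A quantitative form of mean-square continuity: it turns every function
    [t |-> ip (X t) U] into a locally Lipschitz one. *)
Definition ms_locally_lipschitz X := forall M : R, exists2 L, 0 <= L &
  forall s t, `|s| <= M -> `|t| <= M -> nrm (fun x => X t x - X s x) <= L * `|t - s|.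

Definition process_sum X lam a s : T -> R :=
  fun x => tagged_sum (fun t u v => X t x * fine (lam `]u, v]%classic)) a s.

Lemma L2_process_sum X lam a s : second_order P X -> L2 (process_sum X lam a s).
Proof.
move=> X2; elim: s a => [|[v t] s IH] a; first exact: L2_cst.
apply: (@L2D _ _ _ P (fun x => X t x * fine (lam `]a, v]%classic))); last exact: (IH v).
by under eq_fun do rewrite mulrC; apply: L2Z; exact: X2.
Qed.

Lemma ip_process_sum X lam a s U : second_order P X -> L2 U ->
  ip (process_sum X lam a s) U =
  tagged_sum (fun t u v => ip (X t) U * fine (lam `]u, v]%classic)) a s.
Proof.
move=> X2 U2; elim: s a => [|[v t] s IH] a /=; first exact: ip0l.
rewrite -IH /process_sum /= mulrC -ipZl //; last exact: X2.
rewrite -(@ipDl _ _ _ P _ (process_sum X lam v s)) //; last exact: L2_process_sum.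
  by congr ip; apply/funext => x /=; rewrite [_ * X t x]mulrC.
by apply: L2Z; exact: X2.
Qed.

Lemma L2C_toC U : L2C P (toC U) <-> L2 U.
Proof.
split=> [[] //|U2]; split=> //.
by rewrite (_ : (fun x => _) = cst 0) //; exact: (L2_cst P 0).
Qed.

Lemma ms_sqdist_toC U V : L2 U -> L2 V ->
  ms_sqdist P (toC U) (toC V) = (nrm (fun x => U x - V x) ^+ 2)%:E.
Proof.
move=> U2 V2; rewrite -expectation_sqE; last exact: L2B.
rewrite /ms_sqdist; congr ('E_P[_])%E; apply/funext => x.
by rewrite /sqmod /toC /= subr0 expr0n addr0.
Qed.

Lemma tagged_sum_toC (Phi : R -> R -> R -> R) a s :
  tagged_sum (fun t u v => (Phi t u v)%:C) a s = (tagged_sum Phi a s)%:C.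
Proof. by elim: s a => [//|[v t] s IH] a /=; rewrite IH rmorphD. Qed.

(** Real-valued reformulation: the norm of the error replaces its expected
    square. *)
Lemma process_integralP X lam I : second_order P X ->
  process_integral P X lam I <-> exists a b, [/\ a < b, concentrated lam `]a, b]%classic,
    L2 I & forall eps : R, 0 < eps -> exists2 delta, 0 < delta &
      forall s, tagged_partition delta a b s ->
        nrm (fun x => process_sum X lam a s x - I x) <= eps].
Proof.
move=> X2.
have E a s : (fun x => tagged_sum (fun t u v : R =>
    toC (fun x0 => X t x0 * fine (lam `]u, v]%classic)) x) a s) =
    toC (process_sum X lam a s).
  by apply/funext => x; rewrite tagged_sum_toC.
have hS a s := @L2_process_sum X lam a s X2.
split=> -[a [b]].
  case=> ab lD /ms_integralP [/L2C_toC I2 H]; exists a, b; split => // eps e0.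
  have [delta d0 {}H] := H (eps ^+ 2) (exprn_gt0 _ e0); exists delta => // s /H.
  by rewrite E ms_sqdist_toC // lee_fin ler_sqr ?nnegrE ?nrm_ge0 // ltW.
case=> ab lD I2 H; exists a, b; split => //.
apply/ms_integralP; split; first exact/L2C_toC.
move=> eps e0.
have [|delta d0 {}H] := H (Num.sqrt eps); first by rewrite sqrtr_gt0.
exists delta => // s /H Hs; rewrite E ms_sqdist_toC // lee_fin.
by rewrite -[leRHS](sqr_sqrtr (ltW e0)) ler_sqr ?nnegrE ?nrm_ge0 ?sqrtr_ge0.
Qed.

Lemma ip_lipschitz X U L s t : second_order P X -> L2 U ->
  nrm (fun x => X t x - X s x) <= L * `|t - s| ->
  `|ip (X t) U - ip (X s) U| <= L * nrm U * `|t - s|.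
Proof.
move=> X2 U2 hL; rewrite -ipBl //; try exact: X2.
apply: le_trans (cauchy_schwarz (L2B (X2 t) (X2 s)) U2) _.
by rewrite mulrAC ler_wpM2r // nrm_ge0.
Qed.

Lemma ip_locally_lipschitz X U : second_order P X -> ms_locally_lipschitz X -> L2 U ->
  locally_lipschitz (fun t => ip (X t) U).
Proof.
move=> X2 hX U2 M; have [L L0 hL] := hX M.
exists (L * nrm U) => [|s t sM tM]; first by rewrite mulr_ge0 // nrm_ge0.
by apply: ip_lipschitz => //; exact: hL.
Qed.

Lemma ms_locally_lipschitz_shift X h : ms_locally_lipschitz X ->
  ms_locally_lipschitz (fun t => X (t + h)).
Proof.
move=> hX M; have [L L0 hL] := hX (M + `|h|); exists L => // s t sM tM.
have -> : t - s = (t + h) - (s + h) by ring.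
by apply: hL; rewrite (le_trans (ler_normD _ _)) // lerD.
Qed.

Section Fixed.
Variables (X : R -> T -> R) (lam : {charge set (measurableTypeR R) -> \bar R}).
Hypotheses (X2 : second_order P X) (hX : ms_locally_lipschitz X).

(** Testing the vector-valued Riemann sum against [U] gives a scalar Riemann sum,
    whose error is proportional to the norm of [U] with a constant that does not
    depend on [U]. *)
Lemma process_sum_cint a b : concentrated lam `]a, b]%classic -> exists2 K, 0 <= K &
  forall U delta s, L2 U -> 0 <= delta -> tagged_partition delta a b s ->
    `|ip (process_sum X lam a s) U - cint lam (fun t => ip (X t) U)|
      <= K * delta * nrm U.
Proof.
move=> lD; have [L L0 hL] := hX (`|a| + `|b|).
exists (L * total_mass lam) => [|U delta s U2 d0 ts].
  by rewrite mulr_ge0 // total_mass_ge0.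
rewrite ip_process_sum //.
have -> : L * total_mass lam * delta * nrm U = L * nrm U * delta * total_mass lam by ring.
apply: riemann_sum_charge lD _ d0 _ _ ts; first by rewrite mulr_ge0 // nrm_ge0.
  exact: ip_locally_lipschitz.
by move=> u v ub vb; apply: ip_lipschitz => //; apply: hL; exact: itv_norm_bound.
Qed.

(** The integral of a process is determined by its inner products, that is, it is
    also an integral in the weak sense; means and covariances of [X(lambda)] follow
    by choosing [U]. *)
Lemma ip_process_integral I U : process_integral P X lam I -> L2 U ->
  ip I U = cint lam (fun t => ip (X t) U).
Proof.
move=> /(process_integralP _ _ X2) [a [b [ab lD I2 H]]] U2.
have [K K0 hK] := process_sum_cint lD.
set c := cint _ _.
apply/eqP; rewrite -subr_eq0 -normr_le0; apply/ler_addgt0Pl => e e0; rewrite addr0.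
(* Both errors, that of [I] and that of the Riemann sum, are made proportional to
   [e / k], with [k - 1] as the sum of the factors. *)
pose k := (K + 1) * nrm U + 1.
have k0 : 0 < k by rewrite ltr_wpDl // mulr_ge0 ?nrm_ge0 // addr_ge0.
have [|delta d0 {}H] := H (e / k); first by rewrite divr_gt0.
pose eta := Num.min delta (e / k).
have eta0 : 0 < eta by rewrite lt_min d0 divr_gt0.
have [s ts] := tagged_partition_exists eta0 (ltW ab).
have S2 := L2_process_sum lam a s X2.
have H1 := hK U eta s U2 (ltW eta0) ts.
have H2 : `|ip I U - ip (process_sum X lam a s) U| <= e / k * nrm U.
  rewrite -ipBl //; apply: le_trans (cauchy_schwarz (L2B I2 S2) U2) _.
  rewrite ler_wpM2r ?nrm_ge0 // nrmBC; apply: H.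
  by apply: tagged_partitionW ts; rewrite ge_min lexx.
have -> : ip I U - c = (ip I U - ip (process_sum X lam a s) U) +
  (ip (process_sum X lam a s) U - c) by ring.
apply: le_trans (ler_normD _ _) _; apply: le_trans (lerD H2 H1) _.
have H3 : K * eta * nrm U <= K * (e / k) * nrm U.
  by rewrite ler_wpM2r ?nrm_ge0 // ler_wpM2l // ge_min lexx orbT.
apply: le_trans (lerD (lexx _) H3) _.
have -> : e / k * nrm U + K * (e / k) * nrm U = e / k * (k - 1) by rewrite /k; ring.
by rewrite mulrBr mulr1 divfK ?gt_eqF // gerBl divr_ge0 // ltW.
Qed.

(** Riemann sums are compared through their inner product with their own
    difference, which only involves scalar Riemann sums; no common refinement of
    the two partitions is formed. *)
Lemma process_sum_cauchy a b : concentrated lam `]a, b]%classic -> exists2 K, 0 <= K &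
  forall d1 d2 s1 s2, 0 <= d1 -> 0 <= d2 ->
    tagged_partition d1 a b s1 -> tagged_partition d2 a b s2 ->
    nrm (fun x => process_sum X lam a s1 x - process_sum X lam a s2 x)
      <= K * (d1 + d2).
Proof.
move=> lD; have [K K0 hK] := process_sum_cint lD; exists K => // d1 d2 s1 s2 d10 d20 t1 t2.
have S1 := L2_process_sum lam a s1 X2; have S2 := L2_process_sum lam a s2 X2.
(* The difference of the two sums is tested against itself. *)
set U := (fun x => _); have U2 : L2 U by exact: L2B.
have [->|n0] := eqVneq (nrm U) 0; first by rewrite mulr_ge0 // addr_ge0.
have np : 0 < nrm U by rewrite lt_def n0 nrm_ge0.
rewrite -(ler_pM2r np) -expr2 sqr_nrm {1}/U ipBl //.
set c := cint lam (fun t => ip (X t) U).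
have := hK U _ _ U2 d10 t1; have := hK U _ _ U2 d20 t2; rewrite -/c.
rewrite !ler_norml => /andP[h1 h2] /andP[h3 h4].
by rewrite mulrDr mulrDl; lra.
Qed.

Lemma half_exp_small (e : R) : 0 < e -> exists n : nat, (1 / 2) ^+ n <= e.
Proof.
move=> e0; exists (Num.truncn e^-1).
rewrite div1r exprVn invf_ple ?posrE ?exprn_gt0 //.
apply: le_trans (ltW (truncnS_gt _)) _.
by rewrite -natrX ler_nat ltn_expl.
Qed.

(** Riemann sums along partitions of mesh [1 / 2 ^ n] form a Cauchy sequence; its
    limit is also that of all other Riemann sums. *)
Lemma process_integral_exists a b : a < b -> concentrated lam `]a, b]%classic ->
  exists I, process_integral P X lam I.
Proof.
move=> ab lD; have [K K0 hK] := process_sum_cauchy lD.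
have h0 n : 0 < (1 / 2 : R) ^+ n by rewrite exprn_gt0 // divr_gt0.
have /choice [s hs] : forall n, exists s, tagged_partition ((1 / 2) ^+ n) a b s.
  by move=> n; apply: tagged_partition_exists => //; exact: ltW.
pose f n := process_sum X lam a (s n).
have hf n : L2 (f n) by exact: L2_process_sum.
have [n m nm|I I2 hI] := @L2_complete _ _ _ P f (2 * K) hf.
  apply: le_trans (hK _ _ _ _ (ltW (h0 n)) (ltW (h0 m)) (hs n) (hs m)) _.
  rewrite [2 * K]mulrC -mulrA ler_wpM2l //.
  have : (1 / 2 : R) ^+ m <= (1 / 2) ^+ n by apply: ler_wiXn2l => //; lra.
  by set x := _ ^+ m; set y := _ ^+ n; lra.
exists I; apply/process_integralP => //; exists a, b; split => // eps e0.
have k0 : 0 < 4 * K + 1 by lra.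
have d0 : 0 < eps / (4 * K + 1) by rewrite divr_gt0.
exists (eps / (4 * K + 1)) => // s' ts'.
have [n hn] := half_exp_small d0.
apply: le_trans (nrm_triangle _ (hf n) I2) _; first exact: L2_process_sum.
have H1 := hK _ _ _ _ (ltW d0) (ltW (h0 n)) ts' (hs n).
have H2 := hI n; apply: le_trans (lerD H1 H2) _.
apply: (@le_trans _ _ (4 * K * (eps / (4 * K + 1)))).
  have := ler_wpM2l K0 hn.
  rewrite mulrDr; set p := K * _; set q := K * _; move=> pq.
  by rewrite -!mulrA -/p -/q; lra.
apply: (@le_trans _ _ ((4 * K + 1) * (eps / (4 * K + 1)))).
  by rewrite ler_wpM2r ?lerDl // ltW.
by rewrite mulrC divfK // gt_eqF.
Qed.

End Fixed.

Lemma L2_process_integral X lam I : second_order P X -> process_integral P X lam I -> L2 I.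
Proof. by move=> X2 /(process_integralP _ _ X2) [a [b []]]. Qed.

Lemma concentrated_shift h lam a b : concentrated lam `]a, b]%classic ->
  concentrated (shift_charge h lam) `]a + h, b + h]%classic.
Proof.
move=> lD A mA A0; apply: lD.
  by rewrite -[X in measurable X]setTI; exact: measurable_addr.
apply/seteqP; split=> // x [/= Ax]; rewrite in_itv /= => /andP[ax xb].
suff : (A `&` `]a + h, b + h]%classic) (x + h) by rewrite A0.
by split => //=; rewrite in_itv /= ltrD2r lerD2r ax.
Qed.

Lemma concentrated_unshift h lam a b : concentrated (shift_charge h lam) `]a, b]%classic ->
  concentrated lam `]a - h, b - h]%classic.
Proof.
move=> lD A mA A0.
pose B : set (measurableTypeR R) :=
  (fun x : measurableTypeR R => (x - h : measurableTypeR R)) @^-1` A.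
have BA : (fun x : measurableTypeR R => (x + h : measurableTypeR R)) @^-1` B = A.
  by apply/seteqP; split=> x; rewrite /B /= addrK.
rewrite -BA; apply: (lD B).
  by rewrite /B -[X in measurable X]setTI; exact: (measurable_addr (- h)).
apply/seteqP; split=> // x [/= Ax]; rewrite in_itv /= => /andP[ax xb].
suff : (A `&` `]a - h, b - h]%classic) (x - h) by rewrite A0.
by split => //=; rewrite in_itv /= ltrD2r lerD2r ax.
Qed.

Lemma shift_charge_itv h lam (u v : R) :
  shift_charge h lam `]u + h, v + h]%classic = lam `]u, v]%classic.
Proof.
rewrite /shift_charge /pushforward; congr (lam _).
by apply/seteqP; split=> x /=; rewrite !in_itv /= ltrD2r lerD2r.
Qed.

(** The change of variables [t |-> t + h], performed on the tagged partitions. *)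
Lemma process_integral_shift h X lam J : second_order P X ->
  process_integral P X (shift_charge h lam) J ->
  process_integral P (fun t => X (t + h)) lam J.
Proof.
move=> X2 /(process_integralP _ _ X2) [a [b [ab lD J2 H]]].
apply/process_integralP => [t|]; first exact: X2.
exists (a - h), (b - h); split => //; [by rewrite ltrD2r|exact: concentrated_unshift|].
move=> eps /H [delta d0 {}H]; exists delta => // s ts.
have := tagged_partition_shift h ts; rewrite !subrK => /H.
congr (nrm _ <= _); apply/funext => x; congr (_ - _).
rewrite /process_sum -{1}[a](subrK h) tagged_sum_shift.
congr tagged_sum; do 3 apply/funext => ?; congr (_ * fine _).
exact: shift_charge_itv.
Qed.

End ProcessIntegral.

(** * Finitely supported signed measures *)
Section PointCharges.
Context {R : realType}.
Implicit Types (a b : R) (g : R -> R) (c : seq (R * R)).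

Fixpoint point_charge c : {charge set (measurableTypeR R) -> \bar R} :=
  if c is (w, x) :: c' then
    cadd (cscale w (charge_of_finite_measure (dirac (x : measurableTypeR R)))) (point_charge c')
  else czero.

Lemma point_charge_cons w x c (A : set (measurableTypeR R)) :
  point_charge ((w, x) :: c) A = (w%:E * dirac x A + point_charge c A)%E.
Proof. by []. Qed.

Lemma point_chargeE c (A : set (measurableTypeR R)) :
  fine (point_charge c A) = \sum_(p <- c) p.1 * \1_A p.2.
Proof.
have fin x : point_charge x A \is a fin_num.
  elim: x => [|[w x] c' IH]; first by [].
  by rewrite point_charge_cons fin_numD fin_numM.
elim: c => [|[w x] c IH]; first by rewrite big_nil.
rewrite big_cons -IH point_charge_cons.
by rewrite fineD ?fin_numM ?fineM.
Qed.

Lemma point_charge_concentrated c (D : set R) : (forall p, p \in c -> D p.2) ->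
  concentrated (point_charge c) D.
Proof.
elim: c => [//|[w x] c IH] cD A mA AD.
rewrite point_charge_cons IH //; last first.
  by move=> p pc; apply: cD; rewrite inE pc orbT.
rewrite adde0 diracE memNset ?mule0 // => Ax.
suff : (A `&` D) x by rewrite AD.
by split => //; apply: (cD (w, x)); rewrite mem_head.
Qed.

(** Exactly one subinterval contains [x], and its tag is within [delta] of [x]. *)
Lemma tagged_sum_dirac a b g L delta s x : 0 <= L ->
  (forall u v, a <= u <= b -> a <= v <= b -> `|g v - g u| <= L * `|v - u|) ->
  tagged_partition delta a b s -> a < x <= b ->
  `|tagged_sum (fun t u v => g t * \1_(`]u, v]%classic : set R) x) a s - g x| <= L * delta.
Proof.
move=> L0; elim: s a => [|[v t] s IH] a /= hL.
  by move=> -> /andP[ax /(lt_le_trans ax)]; rewrite ltxx.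
case=> av vad /andP[at_ tv] ts /andP[ax xb].
have vb := tagged_partition_le ts.
have [xv|vx] := leP x v.
  have -> : tagged_sum (fun t u v => g t * \1_(`]u, v]%classic : set R) x) v s = 0.
    elim: s v xv ts {IH av vad at_ tv vb} => [//|[v' t'] s IHs] v xv /= [vv' _ _ /IHs ->].
      rewrite indicE memNset ?mulr0 ?addr0 //= in_itv /=.
      by rewrite ltNge xv.
    exact: le_trans (ltW vv').
  rewrite addr0 indicE mem_set ?mulr1 /=; last by rewrite in_itv /= ax.
  apply: le_trans (hL x t _ _) _; [lra|lra|].
  by rewrite ler_wpM2l // ler_norml; lra.
rewrite indicE memNset ?mulr0 ?add0r /=; last by rewrite in_itv /= ax /= leNgt vx.
apply: IH ts _; last by rewrite vx.
by move=> u w ? ?; apply: hL; lra.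
Qed.

(** The integral and the weighted sum are limits of the same Riemann sums. This
    avoids computing the Jordan decomposition of the charge, which would require
    merging the points that coincide. *)
Lemma cint_point_charge c a b g : a < b -> (forall p, p \in c -> a < p.2 <= b) ->
  locally_lipschitz g ->
  cint (point_charge c) g = \sum_(p <- c) p.1 * g p.2.
Proof.
move=> ab cab hg.
have lD : concentrated (point_charge c) `]a, b]%classic.
  by apply: point_charge_concentrated => p /cab; rewrite /= in_itv.
have [L L0 hL0] := hg (`|a| + `|b|).
have hL u v : a <= u <= b -> a <= v <= b -> `|g v - g u| <= L * `|v - u|.
  by move=> ub vb; apply: hL0; exact: itv_norm_bound.
pose C := \sum_(p <- c) `|p.1|.
apply/eqP; rewrite -subr_eq0 -normr_le0; apply/ler_addgt0Pl => e e0; rewrite addr0.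
pose k := L * (C + total_mass (point_charge c)) + 1.
have C0 : 0 <= C by exact: sumr_ge0.
have k0 : 0 < k.
  by have := mulr_ge0 L0 (addr_ge0 C0 (total_mass_ge0 (point_charge c))); rewrite /k; lra.
have d0 : 0 < e / k by rewrite divr_gt0.
have [s ts] := tagged_partition_exists d0 (ltW ab).
have H1 := riemann_sum_charge lD L0 (ltW d0) hg hL ts.
set S := tagged_sum _ _ _ in H1.
have H2 : `|S - \sum_(p <- c) p.1 * g p.2| <= C * (L * (e / k)).
  have -> : S = \sum_(p <- c) p.1 *
      tagged_sum (fun t u v => g t * \1_(`]u, v]%classic : set R) p.2) a s.
    rewrite /S; elim: s a {S H1 ts d0 lD L L0 hL0 hL C k C0 k0 e0 ab cab} => [|[v t] s IH] a /=.
      by rewrite big1 // => p _; rewrite mulr0.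
    rewrite point_chargeE IH mulr_sumr -big_split /=; apply: eq_bigr => p _.
    by rewrite mulrDr mulrCA.
  rewrite -sumrB /C mulr_suml (le_trans (ler_norm_sum _ _ _)) //.
  rewrite big_seq [leRHS]big_seq; apply: ler_sum => p /cab pab.
  by rewrite -mulrBr normrM ler_wpM2l //; exact: tagged_sum_dirac ts pab.
rewrite distrC in H1.
have -> : cint (point_charge c) g - \sum_(p <- c) p.1 * g p.2 =
  (cint (point_charge c) g - S) + (S - \sum_(p <- c) p.1 * g p.2) by ring.
apply: le_trans (ler_normD _ _) _; apply: le_trans (lerD H1 H2) _.
have -> : L * (e / k) * total_mass (point_charge c) + C * (L * (e / k)) = (k - 1) * (e / k).
  by rewrite /k; ring.
by rewrite mulrC mulrBr mulr1 divfK ?gt_eqF // gerBl ltW.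
Qed.

End PointCharges.

(** * Functions annihilated by the allowable measures *)
Section Annihilation.
Context {R : realType}.
Implicit Types (a b s t : R) (f g : R -> R) (lam : {charge set (measurableTypeR R) -> \bar R}).

Definition annihilates d lam :=
  forall p : {poly R}, (size p <= d)%N -> cint lam (horner p) = 0.

Lemma allowableP d lam : allowable d lam ->
  (exists a b, a < b /\ concentrated lam `]a, b]%classic) /\ annihilates d lam.
Proof.
move=> [[K cK lK] lp]; split; last first.
  by move=> p sp; rewrite /cint (lp p sp).
have /compact_bounded [M [_ hM]] := cK.
have {}hM x : K x -> `|x| <= `|M| + 1.
  by move: x; apply: hM; rewrite (le_lt_trans (ler_norm M)) // ltrDl.
exists (- (`|M| + 2)), (`|M| + 2); have M0 := normr_ge0 M; split; first by lra.
move=> A mA A0; apply: lK => //; apply/seteqP; split=> // x [Ax /hM].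
rewrite ler_norml => /andP[x1 x2].
suff : (A `&` `]- (`|M| + 2), (`|M| + 2)]%classic) x by rewrite A0.
by split=> //=; rewrite in_itv /=; apply/andP; split; lra.
Qed.

(** Interpolation at [0, ..., d - 1] recovers the function on each grid, and the
    grids are dense. *)
Lemma fdiff_polynomial d f : (0 < d)%N -> locally_lipschitz f ->
  (forall iota t, fdiff d iota f t = 0) ->
  f =1 fun t => \sum_(j < d) f j%:R * (node_basis j).[t].
Proof.
move=> d0 hf fd; apply: loclip_grid_eq => //.
  by apply: loclip_sum => j; apply: loclipZ; exact: loclip_poly.
by move=> N m n; apply: fdiff_interpolation.
Qed.

Lemma cint_node_sum d lam a b (c : 'I_d -> R) :
  concentrated lam `]a, b]%classic -> annihilates d lam ->
  cint lam (fun t => \sum_(j < d) c j * (node_basis j).[t]) = 0.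
Proof.
move=> lD lp; rewrite (cint_sum lD); last first.
  by move=> j; apply: loclipZ; exact: loclip_poly.
rewrite big1 // => j _; rewrite (cintZ _ lD); last exact: loclip_poly.
by rewrite lp ?mulr0 // size_node_basis.
Qed.

Lemma cint_fdiff_eq0 d lam a b f : (0 < d)%N -> concentrated lam `]a, b]%classic ->
  annihilates d lam -> locally_lipschitz f -> (forall iota t, fdiff d iota f t = 0) ->
  cint lam f = 0.
Proof.
move=> d0 lD lp hf fd.
by rewrite (funext (fdiff_polynomial d0 hf fd)) (cint_node_sum _ lD).
Qed.

(** Both points are moved to a grid that refines the two given ones and starts
    further to the left. *)
Lemma common_grid (N1 m1 n1 N2 m2 n2 : nat) : exists N k1 k2 n : nat,
  - N1%:R + m1%:R * n1.+1%:R^-1 = - N%:R + k1%:R * n.+1%:R^-1 :> R /\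
  - N2%:R + m2%:R * n2.+1%:R^-1 = - N%:R + k2%:R * n.+1%:R^-1 :> R.
Proof.
exists (N1 + N2)%N, (N2 * (n1.+1 * n2.+1) + m1 * n2.+1)%N,
  (N1 * (n1.+1 * n2.+1) + m2 * n1.+1)%N, (n1.+1 * n2.+1).-1.
rewrite prednK ?muln_gt0 // !natrD !natrM.
have u1 : (n1.+1%:R : R) != 0 by rewrite pnatr_eq0.
have u2 : (n2.+1%:R : R) != 0 by rewrite pnatr_eq0.
by move: (n1.+1%:R : R) (n2.+1%:R : R) u1 u2 => x y x0 y0; split; field; rewrite x0 y0.
Qed.

Section TwoVariables.
Variables (d : nat) (D : R -> R -> R).
Hypotheses (d0 : (0 < d)%N) (D1 : forall t, locally_lipschitz (D ^~ t)).
Hypothesis (D2 : forall s, locally_lipschitz (D s)).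
Hypothesis DD : forall iota s t, fdiff d iota (fun u => fdiff d iota (D u) t) s = 0.

(** Each summand is a polynomial of degree less than [d] in one of the variables.
    Only differences with equal steps in [s] and [t] are known to vanish, hence the
    passage through a grid common to the two variables. *)
Lemma fdiff2_polynomial s t :
  D s t = \sum_(j < d) (node_basis j).[s] * D j%:R t +
    \sum_(k < d) (D s k%:R - \sum_(j < d) (node_basis j).[s] * D j%:R k%:R) *
      (node_basis k).[t].
Proof.
pose rhs s t := \sum_(j < d) (node_basis j).[s] * D j%:R t +
    \sum_(k < d) (D s k%:R - \sum_(j < d) (node_basis j).[s] * D j%:R k%:R) *
      (node_basis k).[t].
have rhs1 v : locally_lipschitz (rhs ^~ v).
  apply: loclipD; apply: loclip_sum => j; apply: loclipM.
  - exact: loclip_poly.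
  - exact: loclip_cst.
  - apply: loclipB => //; apply: loclip_sum => k; apply: loclipM.
      exact: loclip_poly.
    exact: loclip_cst.
  - exact: loclip_cst.
have rhs2 u : locally_lipschitz (rhs u).
  apply: loclipD; apply: loclip_sum => j; apply: loclipZ; first exact: D2.
  exact: loclip_poly.
suff H N1 m1 n1 : D (- N1%:R + m1%:R * n1.+1%:R^-1) =1 rhs (- N1%:R + m1%:R * n1.+1%:R^-1).
  by apply: (@loclip_grid_eq _ (D ^~ t) (rhs ^~ t)) => // N m n; exact: H.
apply: loclip_grid_eq => // N2 m2 n2.
have [N [k1 [k2 [n [-> ->]]]]] := common_grid N1 m1 n1 N2 m2 n2.
rewrite (fdiff2_interpolation N k1 k2 d0 (DD _)); congr (_ + _).
by apply: eq_bigr => k _; rewrite mulrC.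
Qed.

(** The inner integral annihilates the terms that are polynomial in [t] and turns
    the others into a polynomial in [s] of degree less than [d], which the outer
    one annihilates. *)
Lemma cint2_fdiff_eq0 lam1 lam2 a1 b1 a2 b2 :
  concentrated lam1 `]a1, b1]%classic -> concentrated lam2 `]a2, b2]%classic ->
  annihilates d lam1 -> annihilates d lam2 ->
  cint lam1 (fun s => cint lam2 (D s)) = 0.
Proof.
move=> l1 l2 p1 p2.
rewrite (_ : (fun s => _) = fun s => \sum_(j < d) cint lam2 (D j%:R) * (node_basis j).[s]).
  exact: cint_node_sum l1 p1.
apply/funext => s; rewrite (funext (fdiff2_polynomial s)) (cintD l2); last 2 first.
- by apply: loclip_sum => j; apply: loclipZ; exact: D2.
- by apply: loclip_sum => j; apply: loclipZ; exact: loclip_poly.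
rewrite (cint_node_sum _ l2 p2) addr0 (cint_sum l2); last first.
  by move=> j; apply: loclipZ; exact: D2.
by apply: eq_bigr => j _; rewrite (cintZ _ l2) // mulrC.
Qed.

End TwoVariables.

End Annihilation.

(** * Intrinsic random functions and stationary increments *)
Section IntrinsicStationaryIncrements.
Context (disp : measure_display) (T : measurableType disp) (R : realType).
Variable P : probability T R.
Implicit Types (X : R -> T -> R) (lam : {charge set (measurableTypeR R) -> \bar R}).
Implicit Types (U V I J : T -> R).

Local Notation L2 := (L2 P).
Local Notation ip := (ip P).

Definition cov U V : R := ip U V - ip U (cst 1) * ip V (cst 1).

Lemma covE U V : L2 U -> L2 V -> covariance P U V = (cov U V)%:E.
Proof. exact: covariance_ip. Qed.

Lemma covC U V : cov U V = cov V U.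
Proof. by rewrite /cov ipC [ip U (cst 1) * _]mulrC. Qed.

Lemma fdiff_shift d iota h (f : R -> R) t :
  fdiff d iota (fun u => f (u + h)) t = fdiff d iota f (t + h).
Proof. by apply: eq_bigr => k _; rewrite addrAC. Qed.

Lemma L2_difference d iota X t : second_order P X -> L2 (difference d iota X t).
Proof. by move=> X2; apply: L2_sum => k; apply: L2Z; exact: X2. Qed.

Lemma ip_difference d iota X t U : second_order P X -> L2 U ->
  ip (difference d iota X t) U = fdiff d iota (fun u => ip (X u) U) t.
Proof.
move=> X2 U2; rewrite ip_suml // => [|k]; last by apply: L2Z; exact: X2.
by apply: eq_bigr => k _; rewrite ipZl //; exact: X2.
Qed.

Lemma cov_difference d iota X t U : second_order P X -> L2 U ->
  cov (difference d iota X t) U = fdiff d iota (fun u => cov (X u) U) t.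
Proof.
move=> X2 U2; rewrite /cov !ip_difference //; last exact: L2_cst.
rewrite fdiffB; congr (_ - _); rewrite mulrC -fdiffZ.
by apply: eq_bigr => k _; rewrite [ip U _ * _]mulrC.
Qed.

Lemma cov_differences d iota X s t : second_order P X ->
  cov (difference d iota X s) (difference d iota X t) =
  fdiff d iota (fun u => fdiff d iota (fun v => cov (X u) (X v)) t) s.
Proof.
move=> X2; rewrite cov_difference //; last exact: L2_difference.
congr fdiff; apply/funext => u; rewrite covC cov_difference //; last exact: X2.
by congr fdiff; apply/funext => v; exact: covC.
Qed.

Lemma loclip_cov X U : second_order P X -> ms_locally_lipschitz P X -> L2 U ->
  locally_lipschitz (fun t => cov (X t) U).
Proof.
move=> X2 hX U2; apply: loclipB; first exact: ip_locally_lipschitz.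
by apply: loclipM; [apply: ip_locally_lipschitz => //; exact: L2_cst|exact: loclip_cst].
Qed.

(** Covariance with [U] is the inner product with [U - E U], so integration against
    [lam] commutes with it. *)
Lemma cov_process_integral_l X lam I U : second_order P X -> ms_locally_lipschitz P X ->
  process_integral P X lam I -> L2 U ->
  cov I U = cint lam (fun t => cov (X t) U).
Proof.
move=> X2 hX XI U2; have [a [b [ab lD _]]] := XI.
rewrite /cov !(ip_process_integral X2 hX XI) //; last exact: L2_cst.
rewrite mulrC -(cintZ _ lD); last by apply: ip_locally_lipschitz => //; exact: L2_cst.
rewrite -(cintB lD); first by congr cint; apply/funext => t; rewrite [ip U _ * _]mulrC.
  exact: ip_locally_lipschitz.
by apply: loclipZ; apply: ip_locally_lipschitz => //; exact: L2_cst.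
Qed.

(** The weights and positions of the measure [lambda] for which [X(lambda)] is the
    difference of order [d] at [t]. For [iota = 0] the positions coincide. *)
Definition difference_points d (iota t : R) : seq (R * R) :=
  [seq ((-1) ^+ k * 'C(d, k)%:R, t - k%:R * iota) | k <- index_iota 0 d.+1].

Definition difference_charge d (iota t : R) := point_charge (difference_points d iota t).

(** Any bound on the positions would do; the margin of [1] makes the interval
    nondegenerate, even for [t = iota = 0]. *)
Definition difference_bound d (iota t : R) : R := `|t| + d%:R * `|iota| + 1.

Lemma difference_bound_gt0 d (iota t : R) : 0 < difference_bound d iota t.
Proof. by rewrite ltr_wpDl // addr_ge0 // mulr_ge0. Qed.

Lemma difference_points_bound d (iota t : R) p : p \in difference_points d iota t ->
  - difference_bound d iota t < p.2 <= difference_bound d iota t.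
Proof.
move=> /mapP[k + ->] /=; rewrite mem_index_iota /= ltnS => kd.
have : `|k%:R * iota| <= d%:R * `|iota|.
  by rewrite normrM normr_nat ler_wpM2r // ler_nat.
rewrite ler_norml => /andP[k1 k2].
have := ler_norm t; have := ler_norm (- t); rewrite normrN => t1 t2.
by rewrite /difference_bound; apply/andP; split; lra.
Qed.

Lemma concentrated_difference d (iota t : R) :
  concentrated (difference_charge d iota t)
    `](- difference_bound d iota t), (difference_bound d iota t)]%classic.
Proof.
apply: point_charge_concentrated => p /difference_points_bound.
by rewrite /= in_itv.
Qed.

Lemma cint_difference_charge d (iota t : R) g : locally_lipschitz g ->
  cint (difference_charge d iota t) g = fdiff d iota g t.
Proof.
move=> hg; rewrite (cint_point_charge _ (@difference_points_bound d iota t)) //.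
  by rewrite big_map big_mkord.
by rewrite gtrN // difference_bound_gt0.
Qed.

(** Differences of order [d] kill the polynomials of degree less than [d]. *)
Lemma allowable_difference d (iota t : R) : allowable d (difference_charge d iota t).
Proof.
have lD := @concentrated_difference d iota t; split.
  set b := difference_bound d iota t in lD.
  exists `[- b, b]%classic; first exact: segment_compact.
  move=> A mA A0; apply: lD => //; apply/seteqP; split=> // x [Ax].
  rewrite /= in_itv /= => /andP[bx xb].
  suff : (A `&` `[- b, b]%classic) x by rewrite A0.
  by split=> //=; rewrite in_itv /= (ltW bx).
move=> p sp; rewrite (cint_charge_integral lD (loclip_poly p)).
by rewrite cint_difference_charge ?fdiff_poly //; exact: loclip_poly.
Qed.

Section Process.
Variables (d : nat) (X : R -> T -> R).
Hypotheses (d0 : (0 < d)%N) (X2 : second_order P X) (hX : ms_locally_lipschitz P X).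

Let L2_one : L2 (cst 1) := L2_cst P 1.

Let X2h h : second_order P (fun t => X (t + h)).
Proof. by move=> t; exact: X2. Qed.

(** With [m] the mean and [K] the covariance of the process, the invariance to be
    shown says that [lambda] annihilates [m (t + h) - m t] and that
    [lambda1 x lambda2] annihilates [K (s + h) (t + h) - K s t]. Stationarity of the
    increments says that the differences of order [d] of these functions vanish,
    which makes the functions polynomial of low degree in the required sense. *)
Lemma intrinsic_of_stationary_increments :
  stationary_increments P d X -> intrinsic_random_function P d X.
Proof.
move=> Xd; split.
- move=> lam /allowableP [[a [b [ab lD]]] _].
  exact: (@process_integral_exists _ _ _ _ _ _ X2 hX a b).
- move=> lam h I J /allowableP [[a [b [ab lD]]] lp] XI /(process_integral_shift X2) XJ.
  rewrite (ip1E (L2_process_integral X2 XI)) (ip1E (L2_process_integral (X2h h) XJ)).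
  congr EFin; apply/eqP; rewrite eq_sym -subr_eq0; apply/eqP.
  rewrite (ip_process_integral X2 hX XI) //.
  rewrite (ip_process_integral (X2h h) (ms_locally_lipschitz_shift h hX) XJ) //.
  have m1 : locally_lipschitz (fun t => ip (X t) (cst 1)) by exact: ip_locally_lipschitz.
  have mh := loclip_shift h m1.
  rewrite -(cintB lD) //; apply: (cint_fdiff_eq0 d0 lD lp); first exact: loclipB.
  move=> iota t; rewrite fdiffB (fdiff_shift _ _ _ (fun u => ip (X u) (cst 1))).
  have [+ _] := Xd iota; move/(_ t h).
  rewrite !ip1E; try exact: L2_difference.
  by rewrite !ip_difference // => -[->]; rewrite subrr.
- move=> lam1 lam2 h I1 I2 J1 J2 /allowableP [[a1 [b1 [ab1 l1]]] p1].
  move=> /allowableP [[a2 [b2 [ab2 l2]]] p2] XI1 XI2.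
  move=> /(process_integral_shift X2) XJ1 /(process_integral_shift X2) XJ2.
  have hXh := ms_locally_lipschitz_shift h hX.
  have I12 := L2_process_integral X2 XI1; have I22 := L2_process_integral X2 XI2.
  have J12 := L2_process_integral (X2h h) XJ1; have J22 := L2_process_integral (X2h h) XJ2.
  rewrite !covE //; congr EFin; apply/eqP; rewrite eq_sym -subr_eq0; apply/eqP.
  rewrite (cov_process_integral_l X2 hX XI1 I22).
  rewrite (cov_process_integral_l (X2h h) hXh XJ1 J22).
  rewrite -(cintB l1); [|exact: (loclip_cov (X2h h) hXh J22)|exact: loclip_cov].
  pose D s t := cov (X (s + h)) (X (t + h)) - cov (X s) (X t).
  have covl U : L2 U -> locally_lipschitz (fun t => cov U (X t)).
    by move=> U2; under eq_fun do rewrite covC; exact: loclip_cov.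
  have covlh U : L2 U -> locally_lipschitz (fun t => cov U (X (t + h))).
    by move=> U2; exact: (loclip_shift h (covl U U2)).
  have DE s : cov (X (s + h)) J2 - cov (X s) I2 = cint lam2 (D s).
    rewrite (cintB l2); [|exact: (covlh _ (X2 _))|exact: (covl _ (X2 _))].
    rewrite covC (cov_process_integral_l (X2h h) hXh XJ2 (X2 _)).
    rewrite [cov _ I2]covC (cov_process_integral_l X2 hX XI2 (X2 _)).
    by congr (cint _ _ - cint _ _); apply/funext => t; exact: covC.
  rewrite (funext DE).
  apply: cint2_fdiff_eq0 l1 l2 p1 p2 => // [t|s|iota s t].
  + apply: loclipB; last exact: (loclip_cov X2 hX (X2 t)).
    exact: (loclip_shift h (loclip_cov X2 hX (X2 (t + h)))).
  + by apply: loclipB; [exact: (covlh _ (X2 _))|exact: (covl _ (X2 _))].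
  + have [_ +] := Xd iota; move/(_ s t h).
    rewrite !covE; try exact: L2_difference.
    rewrite !cov_differences // => -[E].
    rewrite /D.
    transitivity (fdiff d iota (fun u => fdiff d iota (fun v => cov (X (u + h)) (X (v + h))) t
      - fdiff d iota (fun v => cov (X u) (X v)) t) s).
      by congr fdiff; apply/funext => u; rewrite fdiffB.
    rewrite fdiffB E; apply/eqP; rewrite subr_eq0; apply/eqP.
    rewrite -(fdiff_shift _ _ h (fun u => fdiff d iota (fun v => cov (X u) (X v)) (t + h))).
    congr fdiff; apply/funext => u.
    exact: (fdiff_shift _ _ h (fun v => cov (X (u + h)) (X v))).
Qed.

(** The increments are the values of the process at the difference charges. *)
Lemma stationary_increments_of_intrinsic :
  intrinsic_random_function P d X -> stationary_increments P d X.
Proof.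
move=> [Xex Xm Xcov] iota.
have shiftex h t : exists J, process_integral P X
    (shift_charge h (difference_charge d iota t)) J.
  have lD := @concentrated_shift R h _ _ _ (@concentrated_difference d iota t).
  apply: (process_integral_exists X2 hX _ lD); rewrite ltrD2r gtrN //.
  exact: difference_bound_gt0.
split=> [t h|t s h].
- have [I XI] := Xex _ (allowable_difference d iota t).
  have [J XJ] := shiftex h t.
  have := Xm _ _ _ _ (allowable_difference d iota t) XI XJ.
  have {}XJ := process_integral_shift X2 XJ.
  rewrite (ip1E (L2_process_integral X2 XI)) (ip1E (L2_process_integral (X2h h) XJ)).
  rewrite (ip_process_integral X2 hX XI) //.
  rewrite (ip_process_integral (X2h h) (ms_locally_lipschitz_shift h hX) XJ) //.
  have m1 : locally_lipschitz (fun t => ip (X t) (cst 1)) by exact: ip_locally_lipschitz.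
  rewrite !cint_difference_charge //; last exact: (loclip_shift h m1).
  rewrite (fdiff_shift _ _ _ (fun u => ip (X u) (cst 1))) => E.
  by rewrite !ip1E ?ip_difference //; exact: L2_difference.
- have [I1 XI1] := Xex _ (allowable_difference d iota t).
  have [I2 XI2] := Xex _ (allowable_difference d iota s).
  have [J1 XJ1] := shiftex h t.
  have [J2 XJ2] := shiftex h s.
  have := Xcov _ _ _ _ _ _ _ (allowable_difference d iota t)
    (allowable_difference d iota s) XI1 XI2 XJ1 XJ2.
  have {}XJ1 := process_integral_shift X2 XJ1.
  have {}XJ2 := process_integral_shift X2 XJ2.
  have hXh := ms_locally_lipschitz_shift h hX.
  have I12 := L2_process_integral X2 XI1; have I22 := L2_process_integral X2 XI2.
  have J12 := L2_process_integral (X2h h) XJ1; have J22 := L2_process_integral (X2h h) XJ2.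
  rewrite !covE //; try exact: L2_difference.
  rewrite (cov_process_integral_l X2 hX XI1 I22).
  rewrite (cov_process_integral_l (X2h h) hXh XJ1 J22).
  rewrite !cint_difference_charge; last 2 first.
  + exact: (loclip_cov (X2h h) hXh J22).
  + exact: (loclip_cov X2 hX I22).
  move=> [E]; congr EFin.
  rewrite cov_difference //; last exact: L2_difference.
  rewrite cov_difference //; last exact: L2_difference.
  move: E.
  have -> : (fun u => cov (X u) I2) = (fun u => cov (X u) (difference d iota X s)).
    apply/funext => u; rewrite covC (cov_process_integral_l X2 hX XI2 (X2 _)).
    rewrite cint_difference_charge; last exact: (loclip_cov X2 hX (X2 _)).
    by rewrite [RHS]covC cov_difference //; exact: X2.
  move=> ->; rewrite -[RHS]fdiff_shift; congr fdiff; apply/funext => u.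
  rewrite covC (cov_process_integral_l (X2h h) hXh XJ2 (X2 _)).
  rewrite cint_difference_charge; last exact: (loclip_cov (X2h h) hXh (X2 _)).
  rewrite [RHS]covC cov_difference //; last exact: X2.
  exact: (fdiff_shift _ _ h (fun v => cov (X v) (X (u + h)))).
Qed.

End Process.

End IntrinsicStationaryIncrements.

(** * The kernel of the spectral representation *)
Section TaylorKernel.
Local Open Scope complex_scope.
Context {R : realType}.
Implicit Types (d k : nat) (t w x y r : R) (z : R[i]).

Lemma sqmodM z z' : sqmod (z * z') = sqmod z * sqmod z'.
Proof. by case: z => a b; case: z' => c e; rewrite /sqmod /=; ring. Qed.

Lemma sqmodX z n : sqmod (z ^+ n) = sqmod z ^+ n.
Proof.
elim: n => [|n IH]; last by rewrite !exprS sqmodM IH.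
by rewrite !expr0 /sqmod /= expr1n expr0n addr0.
Qed.

Lemma sqmod_ge0 z : 0 <= sqmod z.
Proof. by rewrite addr_ge0 ?sqr_ge0. Qed.

Lemma sqmod1 : sqmod (1 : R[i]) = 1.
Proof. by rewrite /sqmod /= expr1n expr0n addr0. Qed.

Lemma sqmod0 : sqmod (0 : R[i]) = 0.
Proof. by rewrite /sqmod /= expr0n addr0. Qed.

Lemma sqmodV z : sqmod z^-1 = (sqmod z)^-1.
Proof.
have [->|z0] := eqVneq z 0; first by rewrite invr0 sqmod0 invr0.
have H : sqmod z * sqmod z^-1 = 1 by rewrite -sqmodM divff // sqmod1.
have n0 : sqmod z != 0.
  by apply: contra_eq_neq H => ->; rewrite mul0r eq_sym oner_eq0.
by rewrite -[RHS]mulr1 -H mulKf.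
Qed.

(** The kernel depends on [t * w] only. *)
Definition taylor_remainder d x : R[i] :=
  cis x - \sum_(k < d) (0 +i* x) ^+ k / (k`!)%:R.

Let iu : R[i] := 0 +i* 1.

Let ReM_real z x : complex.Re (z * x%:C) = complex.Re z * x.
Proof. by case: z => a b /=; rewrite mulr0 subr0. Qed.

Let ImM_real z x : complex.Im (z * x%:C) = complex.Im z * x.
Proof. by case: z => a b /=; rewrite mulr0 add0r. Qed.

(** Multiplication by [i], which is what turns the derivative of the remainder of
    order [d + 1] into [i] times the remainder of order [d]. *)
Let iuS k : complex.Re (iu ^+ k.+1) = - complex.Im (iu ^+ k) /\
  complex.Im (iu ^+ k.+1) = complex.Re (iu ^+ k).
Proof.
by rewrite exprS; case: (iu ^+ k) => a b /=; rewrite !mul0r !mul1r sub0r add0r.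
Qed.

Let termE k x : (0 +i* x) ^+ k / (k`!)%:R = iu ^+ k * (x ^+ k / k`!%:R)%:C.
Proof.
have -> : 0 +i* x = iu * x%:C.
  by rewrite /iu; apply/eqP; rewrite eq_complex /= !mul0r !mul1r subrr add0r !eqxx.
by rewrite exprMn -mulrA rmorphM rmorphXn fmorphV rmorph_nat.
Qed.

Let Re_sum n (f : 'I_n -> R[i]) : complex.Re (\sum_i f i) = \sum_i complex.Re (f i).
Proof. by apply: (big_morph (@complex.Re R)) => // -[a b] [c e]. Qed.

Let Im_sum n (f : 'I_n -> R[i]) : complex.Im (\sum_i f i) = \sum_i complex.Im (f i).
Proof. by apply: (big_morph (@complex.Im R)) => // -[a b] [c e]. Qed.

Lemma Re_remainder d x : complex.Re (taylor_remainder d x) =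
  cos x - \sum_(k < d) complex.Re (iu ^+ k) * (x ^+ k / k`!%:R).
Proof.
rewrite /taylor_remainder /cis; set S := \sum_(k < d) (_ / _).
have -> : complex.Re ((cos x +i* sin x) - S) = cos x - complex.Re S by case: S.
by rewrite /S Re_sum; congr (_ - _); apply: eq_bigr => k _; rewrite termE ReM_real.
Qed.

Lemma Im_remainder d x : complex.Im (taylor_remainder d x) =
  sin x - \sum_(k < d) complex.Im (iu ^+ k) * (x ^+ k / k`!%:R).
Proof.
rewrite /taylor_remainder /cis; set S := \sum_(k < d) (_ / _).
have -> : complex.Im ((cos x +i* sin x) - S) = sin x - complex.Im S by case: S.
by rewrite /S Im_sum; congr (_ - _); apply: eq_bigr => k _; rewrite termE ImM_real.
Qed.

Let is_derive_sum d (c : nat -> R) x :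
  is_derive x 1 (fun x : R => \sum_(k < d.+1) c k * (x ^+ k / k`!%:R))
    (\sum_(k < d) c k.+1 * (x ^+ k / k`!%:R)).
Proof.
pose p : {poly R} := \poly_(k < d.+1) (c k / k`!%:R).
rewrite (_ : (fun x => _) = horner p); last first.
  by apply/funext => y; rewrite horner_poly; apply: eq_bigr => k _; rewrite mulrAC mulrA.
apply: is_derive_eq.
rewrite (_ : p^`() = \poly_(k < d) (c k.+1 / k`!%:R)).
  by rewrite horner_poly; apply: eq_bigr => k _; rewrite mulrAC mulrA.
apply/polyP => k; rewrite coef_deriv !coef_poly ltnS; case: ifP => _; last exact: mul0rn.
rewrite -[LHS]mulr_natr factS natrM invfM -!mulrA; congr (_ * _).
by rewrite mulrCA mulVf ?mulr1 // pnatr_eq0.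
Qed.

Lemma is_derive_Re_remainder d x : is_derive x 1
  (fun y => complex.Re (taylor_remainder d.+1 y)) (- complex.Im (taylor_remainder d x)).
Proof.
rewrite (funext (Re_remainder d.+1)).
have H := is_deriveB (is_derive_cos x) (is_derive_sum d (fun k => complex.Re (iu ^+ k)) x).
apply: (is_derive_eq H).
rewrite Im_remainder opprB addrC; congr (_ - _).
by rewrite -sumrN; apply: eq_bigr => k _; rewrite (iuS k).1 mulNr opprK.
Qed.

Lemma is_derive_Im_remainder d x : is_derive x 1
  (fun y => complex.Im (taylor_remainder d.+1 y)) (complex.Re (taylor_remainder d x)).
Proof.
rewrite (funext (Im_remainder d.+1)).
have H := is_deriveB (is_derive_sin x) (is_derive_sum d (fun k => complex.Im (iu ^+ k)) x).
apply: (is_derive_eq H).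
by rewrite Re_remainder; congr (_ - _); apply: eq_bigr => k _; rewrite (iuS k).2.
Qed.

Lemma taylor_remainder0 d : taylor_remainder d.+1 0 = 0.
Proof.
rewrite /taylor_remainder /cis cos0 sin0 big_ord_recl big1 => [|k _].
  by rewrite addr0 expr0 fact0 divr1 subrr.
by rewrite [0 +i* 0](_ : _ = 0) // expr0n mul0r.
Qed.

Lemma lipschitz_of_derive (f df : R -> R) (r B x y : R) :
  (forall z : R, is_derive z 1 f (df z)) -> (forall z : R, `|z| <= r -> `|df z| <= B) ->
  `|x| <= r -> `|y| <= r -> `|f y - f x| <= B * `|y - x|.
Proof.
move=> fd dfB; wlog xy : x y / x <= y.
  by have [xy H|yx H] := leP x y; [exact: H|move=> xr yr; rewrite distrC [`|y - x|]distrC H // ltW].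
move=> xr yr; move: xy; rewrite le_eqVlt => /predU1P[->|xy].
  by rewrite !subrr !normr0 mulr0.
have fc : {within `[x, y], continuous f}%classic.
  by apply: derivable_within_continuous => z _; exact: (@ex_derive _ _ _ _ _ _ _ (fd z)).
have [c cxy ->] := MVT xy (fun (t : R) _ => fd t) fc.
rewrite normrM ler_wpM2r // dfB //.
move: cxy; rewrite in_itv /= => /andP[xc cy].
move: xr yr; rewrite !ler_norml => /andP[x1 x2] /andP[y1 y2].
by apply/andP; split; lra.
Qed.

(** Induction on [d]: the remainder of order [d + 1] vanishes at [0] and has the
    remainder of order [d] for derivative, up to a factor [i]. *)
Lemma remainder_bound d x :
  `|complex.Re (taylor_remainder d x)| <= `|x| ^+ d /\
  `|complex.Im (taylor_remainder d x)| <= `|x| ^+ d.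
Proof.
elim: d x => [|d IH] x.
  rewrite expr0 Re_remainder Im_remainder !big_ord0 !subr0 !ler_norml.
  by rewrite cos_geN1 cos_le1 sin_geN1 sin_le1.
have H (z : R) : `|z| <= `|x| -> `|z| ^+ d <= `|x| ^+ d by move=> zx; rewrite lerXn2r ?nnegrE.
split.
- have := @lipschitz_of_derive _ _ `|x| (`|x| ^+ d) 0 x (is_derive_Re_remainder d).
  rewrite taylor_remainder0 /= !subr0 exprSr; apply; rewrite ?normr0 //.
  by move=> z /H zx; rewrite normrN (le_trans (IH z).2).
- have := @lipschitz_of_derive _ _ `|x| (`|x| ^+ d) 0 x (is_derive_Im_remainder d).
  rewrite taylor_remainder0 /= !subr0 exprSr; apply; rewrite ?normr0 //.
  by move=> z /H zx; rewrite (le_trans (IH z).1).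
Qed.

Lemma taylor_remainder_lipschitz d r x y : `|x| <= r -> `|y| <= r ->
  sqmod (taylor_remainder d.+1 y - taylor_remainder d.+1 x) <=
  2 * (r ^+ d * `|y - x|) ^+ 2.
Proof.
move=> xr yr; have r0 : 0 <= r := le_trans (normr_ge0 x) xr.
have H (z : R) : `|z| <= r -> `|z| ^+ d <= r ^+ d by move=> zx; rewrite lerXn2r ?nnegrE.
have hRe : `|complex.Re (taylor_remainder d.+1 y) - complex.Re (taylor_remainder d.+1 x)|
    <= r ^+ d * `|y - x|.
  apply: (@lipschitz_of_derive _ _ r _ x y (is_derive_Re_remainder d)) => // z /H zx.
  by rewrite normrN (le_trans (remainder_bound d z).2).
have hIm : `|complex.Im (taylor_remainder d.+1 y) - complex.Im (taylor_remainder d.+1 x)|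
    <= r ^+ d * `|y - x|.
  apply: (@lipschitz_of_derive _ _ r _ x y (is_derive_Im_remainder d)) => // z /H zx.
  by rewrite (le_trans (remainder_bound d z).1).
have -> : sqmod (taylor_remainder d.+1 y - taylor_remainder d.+1 x) =
   `|complex.Re (taylor_remainder d.+1 y) - complex.Re (taylor_remainder d.+1 x)| ^+ 2 +
   `|complex.Im (taylor_remainder d.+1 y) - complex.Im (taylor_remainder d.+1 x)| ^+ 2.
  rewrite !real_normK ?num_real //.
  by case: (taylor_remainder d.+1 y) => a b; case: (taylor_remainder d.+1 x).
have B0 : 0 <= r ^+ d * `|y - x| by rewrite mulr_ge0 // exprn_ge0.
by rewrite [2 * _]mulrDl mul1r lerD // ler_sqr ?nnegrE ?normr_ge0 ?B0.
Qed.

Lemma taylor_kernelE d t w : taylor_kernel d t w = taylor_remainder d (t * w).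
Proof. by []. Qed.

(** The Lipschitz constant in [t] contains the power of [|w|] that the density
    [(i w) ^ - (d + 1)] of [Z] with respect to [Zy] compensates, at the origin and at
    infinity alike. It comes from the derivative in [t], which is [i w] times the
    kernel of order [d]. *)
Lemma taylor_kernel_lipschitz d M s t w : `|s| <= M -> `|t| <= M ->
  sqmod (taylor_kernel d.+1 t w - taylor_kernel d.+1 s w) <=
  2 * (M ^+ d * `|t - s|) ^+ 2 * (w ^+ 2) ^+ d.+1.
Proof.
move=> sM tM; rewrite !taylor_kernelE.
apply: le_trans (@taylor_remainder_lipschitz d (M * `|w|) _ _ _ _) _.
- by rewrite normrM ler_wpM2r.
- by rewrite normrM ler_wpM2r.
rewrite -mulrBl normrM -[w ^+ 2]real_normK ?num_real //.
rewrite [(`|w| ^+ 2) ^+ d.+1]exprS [(`|w| ^+ 2) ^+ d]exprAC [(M * `|w|) ^+ d]exprMn.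
by rewrite le_eqVlt; apply/orP; left; apply/eqP; ring.
Qed.

End TaylorKernel.

(** * Complex random variables with finite second moment *)
Section ComplexSquareIntegrable.
Local Open Scope complex_scope.
Context (disp : measure_display) (T : measurableType disp) (R : realType).
Variable P : probability T R.
Implicit Types (U V W : T -> R[i]) (c : R[i]).

Local Notation L2 := (L2 P).
Local Notation ip := (ip P).
Local Notation nrm := (nrm P).
Local Notation L2C := (L2C P).

Definition re U : T -> R := fun x => complex.Re (U x).
Definition im U : T -> R := fun x => complex.Im (U x).

(** [csq U] is the second moment of [|U|]; [cre] and [cim] are the real and
    imaginary parts of the expectation of [U] times the conjugate of [V]. *)
Definition csq U : R := ip (re U) (re U) + ip (im U) (im U).
Definition cre U V : R := ip (re U) (re V) + ip (im U) (im V).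
Definition cim U V : R := ip (im U) (re V) - ip (re U) (im V).
Definition orth U V : Prop := cre U V = 0 /\ cim U V = 0.

Lemma reD U V : re (fun x => U x + V x) = fun x => re U x + re V x.
Proof. by apply/funext => x; rewrite /re; case: (U x); case: (V x). Qed.

Lemma imD U V : im (fun x => U x + V x) = fun x => im U x + im V x.
Proof. by apply/funext => x; rewrite /im; case: (U x); case: (V x). Qed.

Lemma reZ c U : re (fun x => c * U x) =
  fun x => complex.Re c * re U x + - complex.Im c * im U x.
Proof. by apply/funext => x; rewrite /re /im; case: c (U x) => a b [e f]; rewrite /= mulNr. Qed.

Lemma imZ c U : im (fun x => c * U x) =
  fun x => complex.Re c * im U x + complex.Im c * re U x.
Proof. by apply/funext => x; rewrite /re /im; case: c (U x) => a b [e f]. Qed.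

Lemma L2CD U V : L2C U -> L2C V -> L2C (fun x => U x + V x).
Proof.
move=> [u1 u2] [v1 v2]; split.
  by rewrite -[X in X \in _]/(re _) reD; exact: L2D.
by rewrite -[X in X \in _]/(im _) imD; exact: L2D.
Qed.

Lemma L2CZ c U : L2C U -> L2C (fun x => c * U x).
Proof.
move=> [u1 u2]; split.
  by rewrite -[X in X \in _]/(re _) reZ; apply: L2D; exact: L2Z.
by rewrite -[X in X \in _]/(im _) imZ; apply: L2D; exact: L2Z.
Qed.

Lemma opp_scaleN1 U V : (fun x => U x - V x) = (fun x => U x + (-1) * V x).
Proof. by apply/funext => x; rewrite mulN1r. Qed.

Lemma L2CB U V : L2C U -> L2C V -> L2C (fun x => U x - V x).
Proof. by move=> hU hV; rewrite opp_scaleN1; apply: L2CD => //; exact: L2CZ. Qed.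

Lemma L2C0 : L2C (fun=> 0).
Proof. by split; exact: (L2_cst P 0). Qed.

Lemma expectation_sqmod U : L2C U -> ('E_P[fun x => sqmod (U x)] = (csq U)%:E)%E.
Proof.
by move=> [u1 u2]; rewrite /csq EFinD -!ipE // -expectationD ?L2M_L1.
Qed.

Lemma ms_sqdistE U V : L2C U -> L2C V ->
  ms_sqdist P U V = (csq (fun x => U x - V x))%:E.
Proof. by move=> hU hV; rewrite -expectation_sqmod //; exact: L2CB. Qed.

Lemma csq_ge0 U : 0 <= csq U.
Proof. by rewrite addr_ge0 // ip_ge0. Qed.

Lemma cre_self U : cre U U = csq U. Proof. by []. Qed.

Lemma creC U V : cre U V = cre V U.
Proof. by rewrite /cre ipC [X in _ + X]ipC. Qed.

Lemma cimC U V : cim U V = - cim V U.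
Proof. by rewrite /cim ipC [ip (re U) _]ipC opprB. Qed.

Lemma orthC U V : orth U V -> orth V U.
Proof. by move=> [h1 h2]; split; rewrite ?(creC V) // cimC h2 oppr0. Qed.

Lemma creDr U V W : L2C U -> L2C V -> L2C W ->
  cre U (fun x => V x + W x) = cre U V + cre U W.
Proof.
move=> [u1 u2] [v1 v2] [w1 w2]; rewrite /cre reD imD !ipDr //; exact: addrACA.
Qed.

Lemma cimDr U V W : L2C U -> L2C V -> L2C W ->
  cim U (fun x => V x + W x) = cim U V + cim U W.
Proof.
move=> [u1 u2] [v1 v2] [w1 w2]; rewrite /cim reD imD !ipDr // opprD; exact: addrACA.
Qed.

Lemma creZr c U V : L2C U -> L2C V ->
  cre U (fun x => c * V x) = complex.Re c * cre U V + complex.Im c * cim U V.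
Proof.
move=> [u1 u2] [v1 v2].
rewrite /cre /cim reZ imZ !ipDr ?ipZr //; try exact: L2Z.
by ring.
Qed.

Lemma cimZr c U V : L2C U -> L2C V ->
  cim U (fun x => c * V x) = complex.Re c * cim U V - complex.Im c * cre U V.
Proof.
move=> [u1 u2] [v1 v2].
rewrite /cre /cim reZ imZ !ipDr ?ipZr //; try exact: L2Z.
by ring.
Qed.

Lemma orthDr U V W : L2C U -> L2C V -> L2C W ->
  orth U V -> orth U W -> orth U (fun x => V x + W x).
Proof. by move=> ? ? ? [a b] [e f]; split; rewrite ?creDr ?cimDr // ?a ?b ?e ?f addr0. Qed.

Lemma orthZr c U V : L2C U -> L2C V -> orth U V -> orth U (fun x => c * V x).
Proof. by move=> ? ? [a b]; split; rewrite ?creZr ?cimZr // a b !mulr0 ?subr0 ?addr0. Qed.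

Lemma orth0r U : orth U (fun=> 0).
Proof.
have E : re (fun=> 0) = fun=> 0 :> R by [].
have E' : im (fun=> 0) = fun=> 0 :> R by [].
by split; rewrite /cre /cim E E' ![ip _ (fun=> 0)]ipC !ip0l ?addr0 ?subr0.
Qed.

Lemma csq0 : csq (fun=> 0) = 0.
Proof. by rewrite -cre_self; have [] := orth0r (fun=> 0). Qed.

Lemma csqZ c U : L2C U -> csq (fun x => c * U x) = sqmod c * csq U.
Proof.
move=> [u1 u2]; rewrite /csq reZ imZ.
have h1 (a b : R) : L2 (fun x => a * re U x + b * im U x) by apply: L2D; exact: L2Z.
have h2 (a b : R) : L2 (fun x => a * im U x + b * re U x) by apply: L2D; exact: L2Z.
rewrite !ipDl ?ipDr ?ipZl ?ipZr //; try exact: L2Z; try exact: h1; try exact: h2.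
rewrite ?ipDr ?ipZr //; try exact: L2Z.
by rewrite (ipC _ (im U) (re U)) /sqmod; ring.
Qed.

Lemma csqD U V : L2C U -> L2C V ->
  csq (fun x => U x + V x) = csq U + csq V + cre U V *+ 2.
Proof.
move=> hU hV; have hUV := L2CD hU hV.
rewrite -cre_self creDr // (creC _ U) (creC _ V) !creDr // !cre_self (creC V U).
by ring.
Qed.

Lemma csqN U : L2C U -> csq (fun x => (-1) * U x) = csq U.
Proof. by move=> hU; rewrite csqZ // /sqmod /= oppr0 expr0n addr0 sqrrN expr1n mul1r. Qed.

Lemma csqBC U V : L2C U -> L2C V -> csq (fun x => U x - V x) = csq (fun x => V x - U x).
Proof.
move=> hU hV; rewrite -(csqN (L2CB hU hV)); congr csq.
by apply/funext => x; rewrite mulN1r opprB.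
Qed.

(** The parallelogram law. Factors of [2] are harmless below, and this form avoids
    square roots. *)
Lemma csqD_le U V : L2C U -> L2C V ->
  csq (fun x => U x + V x) <= 2 * csq U + 2 * csq V.
Proof.
move=> hU hV; have := csq_ge0 (fun x => U x - V x).
rewrite opp_scaleN1 csqD //; last exact: L2CZ.
by rewrite csqN // creZr // /= oppr0 mul0r addr0 [X in _ -> X <= _]csqD //; lra.
Qed.

Lemma csq_approx U V : L2C U -> L2C V ->
  csq U <= 2 * csq (fun x => V x - U x) + 2 * csq V.
Proof.
move=> hU hV; rewrite (csqBC hV hU).
apply: le_trans (csqD_le (L2CB hU hV) hV).
by rewrite le_eqVlt; apply/orP; left; apply/eqP; congr csq; apply/funext => x; rewrite subrK.
Qed.

Lemma orthP U V : L2C U -> L2C V -> ms_orthogonal P U V <-> orth U V.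
Proof.
move=> [u1 u2] [v1 v2]; rewrite /ms_orthogonal.
have -> : ('E_P[fun x => complex.Re (U x * conjc (V x))%R] = (cre U V)%:E)%E.
  rewrite /cre EFinD -!ipE // -expectationD ?L2M_L1 //.
  congr ('E_P[_])%E; apply/funext => x; rewrite /re /im /=.
  by case: (U x) (V x) => a b [e f] /=; rewrite mulrN opprK.
have -> : ('E_P[fun x => complex.Im (U x * conjc (V x))%R] = (cim U V)%:E)%E.
  rewrite /cim EFinB -!ipE // -expectationB ?L2M_L1 //.
  congr ('E_P[_])%E; apply/funext => x; rewrite /re /im /=.
  by case: (U x) (V x) => a b [e f] /=; rewrite mulrN addrC.
by split=> [[[h1] [h2]]|[-> ->]].
Qed.

Lemma nrm_re_le U : nrm (re U) <= Num.sqrt (csq U).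
Proof. by rewrite ler_sqrt ?csq_ge0 // lerDl ip_ge0. Qed.

Lemma nrm_im_le U : nrm (im U) <= Num.sqrt (csq U).
Proof. by rewrite ler_sqrt ?csq_ge0 // lerDr ip_ge0. Qed.

(** [cre U] and [cim U] are continuous for the mean-square distance. *)
Lemma orth_limit U V : L2C U -> L2C V ->
  (forall e : R, 0 < e -> exists V', [/\ L2C V', orth U V' & csq (fun x => V' x - V x) <= e]) ->
  orth U V.
Proof.
move=> U2 V2 H.
pose k := nrm (re U) + nrm (im U) + 1.
have k0 : 0 < k by rewrite ltr_wpDl // addr_ge0 // nrm_ge0.
have small (z : R) : (forall W, L2C W -> orth U (fun x => W x + V x) ->
    `|z| <= (nrm (re U) + nrm (im U)) * Num.sqrt (csq W)) -> z = 0.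
  move=> hz; apply/eqP; rewrite -normr_le0; apply/ler_addgt0Pl => e e0; rewrite addr0.
  have [|V' [V'2 oV' hV']] := H ((e / k) ^+ 2); first by rewrite exprn_gt0 // divr_gt0.
  have := hz (fun x => V' x - V x) (L2CB V'2 V2).
  rewrite (_ : (fun x => V' x - V x + V x) = V'); last by apply/funext => x; rewrite subrK.
  move=> /(_ oV') /le_trans; apply.
  have ek0 : 0 < e / k by rewrite divr_gt0.
  have : Num.sqrt (csq (fun x => V' x - V x)) <= e / k.
    by rewrite -(ger0_norm (ltW ek0)) -sqrtr_sqr ler_sqrt // sqr_ge0.
  move=> hs; apply: le_trans (ler_wpM2l _ hs) _; first by rewrite addr_ge0 // nrm_ge0.
  apply: (@le_trans _ _ (k * (e / k))); last by rewrite mulrC divfK // gt_eqF.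
  by rewrite ler_pM2r // lerDl.
have bound (a b : T -> R) W : L2C W -> L2 a ->
   b \in [:: re W; im W] -> L2 b -> `|ip a b| <= nrm a * Num.sqrt (csq W).
  move=> W2 a2 bW b2; apply: le_trans (cauchy_schwarz a2 b2) _.
  rewrite ler_wpM2l ?nrm_ge0 //; move: bW; rewrite !inE => /orP[] /eqP ->.
    exact: nrm_re_le.
  exact: nrm_im_le.
have [U21 U22] : L2 (re U) /\ L2 (im U) := U2.
split.
  apply: small => V1 V12 [q1 q2]; have [W21 W22] : L2 (re V1) /\ L2 (im V1) := V12.
  move: q1; rewrite creDr // => /eqP; rewrite addrC addr_eq0 => /eqP ->.
  rewrite normrN /cre (le_trans (ler_normD _ _)) // mulrDl lerD //.
    by apply: bound => //; rewrite !inE eqxx.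
  by apply: bound => //; rewrite !inE eqxx orbT.
apply: small => V1 V12 [q1 q2]; have [W21 W22] : L2 (re V1) /\ L2 (im V1) := V12.
move: q2; rewrite cimDr // => /eqP; rewrite addrC addr_eq0 => /eqP ->.
rewrite normrN /cim addrC (le_trans (ler_normD _ _)) // normrN mulrDl lerD //.
  by apply: bound => //; rewrite !inE eqxx ?orbT.
by apply: bound => //; rewrite !inE eqxx ?orbT.
Qed.

End ComplexSquareIntegrable.

(** * Stochastic integrals with orthogonal increments *)
Section OrthogonalIncrements.
Local Open Scope complex_scope.
Context (disp : measure_display) (T : measurableType disp) (R : realType).
Variable P : probability T R.
Implicit Types (a b u v t w delta : R) (g : R -> R[i]) (W : R -> T -> R[i]).
Implicit Types (U I J : T -> R[i]).

Local Notation L2C := (L2C P).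
Local Notation csq := (csq P).
Local Notation orth := (orth P).

Definition incr W u v : T -> R[i] := fun x => W v x - W u x.

Definition stieltjes_sum g W a s : T -> R[i] :=
  fun x => tagged_sum (fun t u v => g t * (W v x - W u x)) a s.

Definition L2_increments W a b : Prop :=
  forall u v, a <= u -> u <= v -> v <= b -> L2C (incr W u v).

Definition orth_increments W a b : Prop :=
  forall u v u' v', a <= u -> u <= v -> v <= u' -> u' <= v' -> v' <= b ->
    orth (incr W u v) (incr W u' v').

Lemma L2C_stieltjes_sum g W a b delta s : L2_increments W a b ->
  tagged_partition delta a b s -> L2C (stieltjes_sum g W a s).
Proof.
elim: s a => [|[v t] s IH] a hW /=; first by move=> _; exact: L2C0.
case=> av _ _ ts; have vb := tagged_partition_le ts.
apply: (L2CD (L2CZ (g t) (hW a v (lexx a) (ltW av) vb))).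
apply: IH ts => u w vu; apply: hW; exact: le_trans (ltW av) vu.
Qed.

Lemma orth_stieltjes_sum U g W a b delta s : L2C U -> L2_increments W a b ->
  (forall u v, a <= u -> u <= v -> v <= b -> orth U (incr W u v)) ->
  tagged_partition delta a b s -> orth U (stieltjes_sum g W a s).
Proof.
move=> U2; elim: s a => [|[v t] s IH] a hW hU /=; first by move=> _; exact: orth0r.
case=> av _ _ ts; have vb := tagged_partition_le ts.
have hWv : L2_increments W v b.
  by move=> u w vu; apply: hW; exact: le_trans (ltW av) vu.
have Wav : L2C (incr W a v) := hW a v (lexx a) (ltW av) vb.
apply: (orthDr U2 (L2CZ (g t) Wav) (L2C_stieltjes_sum g hWv ts)).
  by apply: orthZr => //; exact: hU (lexx a) (ltW av) vb.
by apply: IH ts => // u w vu; apply: hU; exact: le_trans (ltW av) vu.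
Qed.

(** Pythagoras: the second moment of the sum is the sum of the second moments,
    and the bound for the subintervals telescopes. *)
Lemma csq_stieltjes_sum g W (F : R -> R) (C : R) a b delta s : L2_increments W a b ->
  orth_increments W a b ->
  (forall t u v, a <= u -> u < v -> v <= b -> u <= t <= v -> v - u < delta ->
    sqmod (g t) * csq (incr W u v) <= C * (F v - F u)) ->
  tagged_partition delta a b s -> csq (stieltjes_sum g W a s) <= C * (F b - F a).
Proof.
elim: s a => [|[v t] s IH] a hW oW hF /=.
  by move=> ->; rewrite subrr mulr0 (csq0 P).
case=> av vad avt ts; have vb := tagged_partition_le ts.
have hWv : L2_increments W v b.
  by move=> u w vu; apply: hW; exact: le_trans (ltW av) vu.
have Wav : L2C (incr W a v) := hW a v (lexx a) (ltW av) vb.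
have ov : orth (stieltjes_sum g W v s) (incr W a v).
  apply/orthC; apply: orth_stieltjes_sum Wav hWv _ ts => u w vu uw wb.
  exact: oW (lexx a) (ltW av) vu uw wb.
have S2 := L2C_stieltjes_sum g hWv ts.
have [h1 _] := orthZr (g t) S2 Wav ov.
rewrite -[stieltjes_sum _ _ _ _]/(fun x => g t * incr W a v x + stieltjes_sum g W v s x).
rewrite csqD //; last exact: L2CZ.
rewrite creC h1 mul0rn addr0 csqZ //.
have -> : C * (F b - F a) = C * (F v - F a) + C * (F b - F v) by ring.
rewrite lerD //; first exact: hF.
apply: IH ts => //.
  by move=> u w u' w' vu; apply: oW; exact: le_trans (ltW av) vu.
by move=> t' u w vu; apply: hF; exact: le_trans (ltW av) vu.
Qed.

(** [stieltjes] in terms of [tagged_partition] and [csq]. *)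
Definition cstieltjes g W a b I : Prop := L2C I /\
  forall e : R, 0 < e -> exists2 delta, 0 < delta &
    forall s, tagged_partition delta a b s -> csq (fun x => stieltjes_sum g W a s x - I x) <= e.

Lemma stieltjesP g W a b I : L2_increments W a b -> stieltjes P g W a b I ->
  cstieltjes g W a b I.
Proof.
move=> hW /ms_integralP [I2 H]; split=> // e /H [delta d0 {}H].
exists delta => // s ts; rewrite -lee_fin -ms_sqdistE //; first exact: H.
exact: L2C_stieltjes_sum ts.
Qed.

Lemma cstieltjes_approx g W a b I delta e : a <= b -> 0 < delta -> 0 < e ->
  cstieltjes g W a b I -> exists2 s, tagged_partition delta a b s &
    csq (fun x => stieltjes_sum g W a s x - I x) <= e.
Proof.
move=> ab d0 e0 [_ /(_ e e0)] [delta' d'0 H].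
have [|s ts] := @tagged_partition_exists R (Num.min delta delta') a b _ ab.
  by rewrite lt_min d0.
exists s; first by apply: tagged_partitionW ts; rewrite ge_min lexx.
by apply: H; apply: tagged_partitionW ts; rewrite ge_min lexx orbT.
Qed.

Lemma cstieltjesB g1 g2 W a b I1 I2 : L2_increments W a b ->
  cstieltjes g1 W a b I1 -> cstieltjes g2 W a b I2 ->
  cstieltjes (fun w => g1 w - g2 w) W a b (fun x => I1 x - I2 x).
Proof.
move=> hW [I12 H1] [I22 H2]; split; first exact: L2CB.
move=> e e0; have e4 : 0 < e / 4 by rewrite divr_gt0.
have [d1 d10 {}H1] := H1 _ e4; have [d2 d20 {}H2] := H2 _ e4.
exists (Num.min d1 d2); first by rewrite lt_min d10.
move=> s ts.
have t1 : tagged_partition d1 a b s by apply: tagged_partitionW ts; rewrite ge_min lexx.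
have t2 : tagged_partition d2 a b s.
  by apply: tagged_partitionW ts; rewrite ge_min lexx orbT.
have S1 := L2C_stieltjes_sum g1 hW ts; have S2 := L2C_stieltjes_sum g2 hW ts.
have -> : (fun x => stieltjes_sum (fun w => g1 w - g2 w) W a s x - (I1 x - I2 x)) =
  (fun x => (stieltjes_sum g1 W a s x - I1 x) + (I2 x - stieltjes_sum g2 W a s x)).
  apply/funext => x; rewrite /stieltjes_sum.
  have -> : tagged_sum (fun t u v => (g1 t - g2 t) * (W v x - W u x)) a s =
     tagged_sum (fun t u v => g1 t * (W v x - W u x)) a s -
     tagged_sum (fun t u v => g2 t * (W v x - W u x)) a s.
    rewrite -tagged_sumB; congr tagged_sum.
    by do 3 apply/funext => ?; rewrite mulrBl.
  by ring.
apply: le_trans (csqD_le (L2CB S1 I12) (L2CB I22 S2)) _.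
rewrite (csqBC I22 S2); have := H1 _ t1; have := H2 _ t2; lra.
Qed.

(** The hypothesis on subintervals is only required for fine partitions: a bound
    comparing [g] at the tag with the increment over the whole subinterval can then
    use that the tag is close. *)
Lemma cstieltjes_bound g W (F : R -> R) (C : R) a b delta I : a <= b -> 0 < delta ->
  L2_increments W a b -> orth_increments W a b ->
  (forall t u v, a <= u -> u < v -> v <= b -> u <= t <= v -> v - u < delta ->
    sqmod (g t) * csq (incr W u v) <= C * (F v - F u)) ->
  cstieltjes g W a b I -> csq I <= 2 * (C * (F b - F a)).
Proof.
move=> ab d0 hW oW hF hI; apply/ler_addgt0Pr => e e0.
have e2 : 0 < e / 2 by rewrite divr_gt0.
have [s ts hs] := cstieltjes_approx ab d0 e2 hI.
apply: le_trans (csq_approx hI.1 (L2C_stieltjes_sum g hW ts)) _.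
have := csq_stieltjes_sum hW oW hF ts; lra.
Qed.

Lemma orth_cstieltjes U g W a b I : a <= b -> L2C U -> L2_increments W a b ->
  (forall u v, a <= u -> u <= v -> v <= b -> orth U (incr W u v)) ->
  cstieltjes g W a b I -> orth U I.
Proof.
move=> ab U2 hW hU hI; apply: orth_limit => // [|e e0]; first exact: hI.1.
have [s ts hs] := cstieltjes_approx ab ltr01 e0 hI.
by exists (stieltjes_sum g W a s); split => //;
  [exact: L2C_stieltjes_sum ts|exact: orth_stieltjes_sum ts].
Qed.

End OrthogonalIncrements.

(** * The spectral integrals are Lipschitz in the kernel *)
Section SpectralContinuity.
Local Open Scope complex_scope.
Context (disp : measure_display) (T : measurableType disp) (R : realType).
Variable P : probability T R.
Implicit Types (a b u v t w delta : R) (g : R -> R[i]) (W : R -> T -> R[i]).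
Implicit Types (U I J : T -> R[i]).

Local Notation L2C := (L2C P).
Local Notation csq := (csq P).
Local Notation orth := (orth P).

Variables (d : nat) (Zy Z : R -> T -> R[i]) (F : R -> R) (M : R).
Hypotheses (F_homo : {homo F : w1 w2 / w1 <= w2}) (F_bounded : forall w, `|F w| <= M).
Hypothesis Zy_L2 : forall u v, u <= v -> L2C (incr Zy u v).
Hypothesis Zy_orth : forall u v u' v', u <= v -> v <= u' -> u' <= v' ->
  orth (incr Zy u v) (incr Zy u' v').
Hypothesis Zy_F : forall u v, u <= v -> csq (incr Zy u v) = F v - F u.
Hypothesis ZE : forall w1 w2, w1 <= w2 -> (0 < w1) || (w2 < 0) ->
  stieltjes P (fun w => ((0 +i* w) ^+ d)^-1) Zy w1 w2 (incr Z w1 w2).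

Let Zy_L2_on a b : L2_increments P Zy a b.
Proof. by move=> u v _ uv _; exact: Zy_L2. Qed.

Let Zy_orth_on a b : orth_increments P Zy a b.
Proof. by move=> u v u' v' _ uv vu uv' _; exact: Zy_orth. Qed.

Let ZE' w1 w2 : w1 <= w2 -> (0 < w1) || (w2 < 0) ->
  cstieltjes P (fun w => ((0 +i* w) ^+ d)^-1) Zy w1 w2 (incr Z w1 w2).
Proof. by move=> w12 w0; apply: stieltjesP => //; exact: ZE. Qed.

Lemma off_zero_sub a b u v : (0 < a) || (b < 0) -> a <= u -> v <= b -> (0 < u) || (v < 0).
Proof.
move=> /orP[a0|b0] au vb; apply/orP; [left; exact: lt_le_trans au|].
by right; exact: le_lt_trans vb _.
Qed.

Lemma sqmod_density w : sqmod ((0 +i* w) ^+ d)^-1 = ((w ^+ 2) ^+ d)^-1.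
Proof. by rewrite sqmodV sqmodX /sqmod /= expr0n add0r. Qed.

(** The increment of [Z] is the integral of [(i w) ^ - d] with respect to [Zy], and
    [|(i w) ^ - d| ^ 2] is at most [m ^ - d] on the interval. *)
Lemma csq_incrZ u v (m : R) : u <= v -> (0 < u) || (v < 0) -> 0 < m ->
  (forall w, u <= w <= v -> m <= w ^+ 2) ->
  csq (incr Z u v) <= 2 * ((m ^+ d)^-1 * (F v - F u)).
Proof.
move=> uv uv0 m0 hm.
apply: (cstieltjes_bound (F := F) uv ltr01 (@Zy_L2_on u v) (@Zy_orth_on u v) _ (ZE' uv uv0)).
move=> t p q up pq qv /andP[pt tq] _.
rewrite Zy_F ?(ltW pq) // sqmod_density ler_wpM2r ?subr_ge0 ?F_homo ?(ltW pq) //.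
have tm : m <= t ^+ 2 by apply: hm; rewrite (le_trans up pt) (le_trans tq qv).
have t0 := lt_le_trans m0 tm.
rewrite lef_pV2 ?posrE; [|exact: exprn_gt0|exact: exprn_gt0].
by rewrite lerXn2r ?nnegrE // ltW.
Qed.

Lemma Z_L2_on a b : (0 < a) || (b < 0) -> L2_increments P Z a b.
Proof.
move=> ab0 u v au uv vb; have [] // := ZE' uv _.
exact: off_zero_sub ab0 au vb.
Qed.

(** Increments of [Z] are limits of combinations of increments of [Zy] over the
    same interval; orthogonality passes to the limit in one factor at a time. *)
Lemma Z_orth_on a b : (0 < a) || (b < 0) -> orth_increments P Z a b.
Proof.
move=> ab0 u v u' v' au uv vu' uv' vb.
have uv0 : (0 < u) || (v < 0).
  by apply: off_zero_sub ab0 au _; rewrite (le_trans vu') // (le_trans uv').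
have uv'0 : (0 < u') || (v' < 0).
  by apply: off_zero_sub ab0 _ vb; rewrite (le_trans au) // (le_trans uv).
have Z2 : L2C (incr Z u v) by have [] := ZE' uv uv0.
have Z'2 : L2C (incr Z u' v') by have [] := ZE' uv' uv'0.
apply/orthC; apply: (orth_cstieltjes uv Z'2 (@Zy_L2_on u v) _ (ZE' uv uv0)) => p q up pq qv.
apply/orthC; apply: (orth_cstieltjes uv' (Zy_L2 pq) (@Zy_L2_on u' v') _ (ZE' uv' uv'0)).
by move=> p' q' up' pq' _; apply: Zy_orth => //; rewrite (le_trans qv) // (le_trans vu').
Qed.

(** The integrator has density [(i w) ^ - d], so [|g w| ^ 2 / w ^ (2 d)] is what
    is integrated against [dF]. On a fine partition [w ^ 2] is at least a quarter of
    its value at the tag, hence the factor [4 ^ d]. *)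
Lemma csq_stieltjesZ g a b (C : R) I : a <= b -> (0 < a) || (b < 0) -> 0 <= C ->
  (forall w, sqmod (g w) <= C * (w ^+ 2) ^+ d) ->
  cstieltjes P g Z a b I -> csq I <= 4 * 4 ^+ d * C * (F b - F a).
Proof.
move=> ab ab0 C0 hg hI.
(* [e0] is the distance from the interval to the origin; a mesh below [e0 / 2]
   keeps [|w|] above [|t| / 2] for [w] in the subinterval of the tag [t]. *)
have [e0 e0p he0] : exists2 e0, 0 < e0 & forall w, a <= w <= b -> e0 <= `|w|.
  move: ab0 => /orP[a0|b0].
    by exists a => // w /andP[aw _]; rewrite ger0_norm // (le_trans (ltW a0)).
  exists (- b) => [|w /andP[_ wb]]; first by rewrite oppr_gt0.
  by rewrite ler0_norm ?lerN2 // (le_trans wb) // ltW.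
have -> : 4 * 4 ^+ d * C * (F b - F a) = 2 * (2 * 4 ^+ d * C * (F b - F a)) by ring.
have d0 : 0 < e0 / 2 by rewrite divr_gt0.
apply: (cstieltjes_bound (F := F) ab d0 (Z_L2_on ab0) (Z_orth_on ab0) _ hI).
move=> t u v au uv vb /andP[ut tv] vu.
have t0 : e0 <= `|t| by apply: he0; rewrite (le_trans au ut) (le_trans tv vb).
have t2 : 0 < t ^+ 2 by rewrite exprn_even_gt0 //= -normr_gt0 (lt_le_trans e0p).
have m0 : 0 < t ^+ 2 / 4 by rewrite divr_gt0.
have hm w : u <= w <= v -> t ^+ 2 / 4 <= w ^+ 2.
  move=> /andP[uw wv].
  have : `|t| / 2 <= `|w|.
    have : `|t - w| <= e0 / 2 by rewrite ler_norml; lra.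
    have := ler_normD (t - w) w; rewrite subrK; lra.
  have t20 : 0 <= `|t| / 2 by rewrite divr_ge0.
  rewrite -(@ler_sqr _ (`|t| / 2)) ?nnegrE // real_normK ?num_real //.
  rewrite exprMn real_normK ?num_real //.
  by have -> : (2^-1 : R) ^+ 2 = 4^-1 by field.
have uv0 := off_zero_sub ab0 au vb.
apply: le_trans (ler_pM (sqmod_ge0 _) (csq_ge0 _ _) (hg t) (csq_incrZ (ltW uv) uv0 m0 hm)) _.
rewrite le_eqVlt; apply/orP; left; apply/eqP.
rewrite [(t ^+ 2 / 4) ^+ d]exprMn exprVn invfM invrK.
have n0 : (t ^+ 2) ^+ d != 0 by rewrite expf_neq0 // gt_eqF.
by move: ((t ^+ 2) ^+ d) n0 => x x0; field.
Qed.

Let FB u v : F v - F u <= 2 * M.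
Proof.
have := F_bounded v; have := F_bounded u.
by rewrite !ler_norml; lra.
Qed.

(** The bound of [csq_stieltjesZ] depends on the truncation of the line only through
    the increment of [F], which is bounded, so it passes to the limit. *)
Lemma csq_punctured g1 g2 (C : R) I1 I2 : 0 <= C ->
  (forall w, sqmod (g1 w - g2 w) <= C * (w ^+ 2) ^+ d) ->
  stieltjes_punctured P g1 Z I1 -> stieltjes_punctured P g2 Z I2 ->
  csq (fun x => I1 x - I2 x) <= 64 * 4 ^+ d * M * C.
Proof.
move=> C0 hg [I12 [J1 [K1 [hJ1 cv1]]]] [I22 [J2 [K2 [hJ2 cv2]]]].
apply/ler_addgt0Pr => e e0.
have e8 : 0 < e / 8 by rewrite divr_gt0.
have near0 : \forall y \near (0 : \bar R)%E, (y < (e / 8)%:E)%E.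
  by apply: open_ereal_lt'; rewrite lte_fin.
have nearp : \forall p \near filter_prod (0 : R)^'+ (pinfty_nbhs R), 0 < p.1 < 1 /\ 1 < p.2.
  exists ([set x | 0 < x < 1], [set x | 1 < x]) => /=.
    split; last exact: nbhs_pinfty_gt.
    by near=> x; apply/andP; split; near: x; [exact: nbhs_right_gt|exact: nbhs_right_lt].
  by move=> [x y] /= [].
have near1 : \forall p \near filter_prod (0 : R)^'+ (pinfty_nbhs R),
  (ms_sqdist P (fun x => (J1 p.1 p.2 x + K1 p.1 p.2 x)%R) I1 < (e / 8)%:E)%E := cv1 _ near0.
have near2 : \forall p \near filter_prod (0 : R)^'+ (pinfty_nbhs R),
  (ms_sqdist P (fun x => (J2 p.1 p.2 x + K2 p.1 p.2 x)%R) I2 < (e / 8)%:E)%E := cv2 _ near0.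
have [[e1 A] [h1 h2 [/andP[/= e10 e11] /= A1]]] : exists p, [/\
    (ms_sqdist P (fun x => (J1 p.1 p.2 x + K1 p.1 p.2 x)%R) I1 < (e / 8)%:E)%E,
    (ms_sqdist P (fun x => (J2 p.1 p.2 x + K2 p.1 p.2 x)%R) I2 < (e / 8)%:E)%E &
    0 < p.1 < 1 /\ 1 < p.2].
  near (filter_prod (0 : R)^'+ (pinfty_nbhs R)) => p.
  by exists p; split; near: p.
move: h1 h2 => /= h1 h2.
have eA : e1 < A := lt_trans e11 A1.
have [sJ1 sK1] := hJ1 e1 A e10 eA; have [sJ2 sK2] := hJ2 e1 A e10 eA.
have nA : - A <= - e1 by rewrite lerN2 ltW.
have n0 : (0 < - A) || (- e1 < 0) by rewrite oppr_lt0 e10 orbT.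
have p0 : (0 < e1) || (A < 0) by rewrite e10.
have cJ1 := stieltjesP (Z_L2_on n0) sJ1; have cJ2 := stieltjesP (Z_L2_on n0) sJ2.
have cK1 := stieltjesP (Z_L2_on p0) sK1; have cK2 := stieltjesP (Z_L2_on p0) sK2.
have hJ := csq_stieltjesZ nA n0 C0 hg (cstieltjesB (Z_L2_on n0) cJ1 cJ2).
have hK := csq_stieltjesZ (ltW eA) p0 C0 hg (cstieltjesB (Z_L2_on p0) cK1 cK2).
have J12 := cJ1.1; have J22 := cJ2.1; have K12 := cK1.1; have K22 := cK2.1.
have S1 := L2CD J12 K12; have S2 := L2CD J22 K22.
rewrite ms_sqdistE // lte_fin in h1; rewrite ms_sqdistE // lte_fin in h2.
set D1 := csq (fun x => _) in h1; set D2 := csq (fun x => _) in h2.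
have B0 : 0 <= 4 * 4 ^+ d * C by rewrite !mulr_ge0 // exprn_ge0.
have hJ' := le_trans hJ (ler_wpM2l B0 (FB _ _)).
have hK' := le_trans hK (ler_wpM2l B0 (FB _ _)).
have DI := L2CB I12 I22.
have DJ := L2CB J12 J22; have DK := L2CB K12 K22.
have H1 := csq_approx DI (L2CD DJ DK).
have H2 := csqD_le DJ DK.
have H3 : csq (fun x => (J1 e1 A x - J2 e1 A x) + (K1 e1 A x - K2 e1 A x) - (I1 x - I2 x))
    <= 2 * D1 + 2 * D2.
  have -> : D2 = csq (fun x => I2 x - (J2 e1 A x + K2 e1 A x)) by exact: csqBC.
  apply: le_trans (csqD_le (L2CB S1 I12) (L2CB I22 S2)).
  rewrite le_eqVlt; apply/orP; left; apply/eqP; congr csq; apply/funext => x.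
  by ring.
have -> : 64 * 4 ^+ d * M * C = 8 * (4 * 4 ^+ d * C * (2 * M)) by ring.
by move: (4 * 4 ^+ d * C * (2 * M)) hJ' hK' => B hJ' hK'; lra.
Unshelve. all: by end_near. Qed.

End SpectralContinuity.

(** * Mean-square regularity of the process *)
Section SpectralProcess.
Local Open Scope complex_scope.
Context (disp : measure_display) (T : measurableType disp) (R : realType).
Variable P : probability T R.

Lemma nrm_ae (U V : T -> R) : measurable_fun [set: T] U -> measurable_fun [set: T] V ->
  {ae P, forall x, U x = V x} -> nrm P U = nrm P V.
Proof.
move=> mU mV UV; rewrite /nrm /ip; congr (Num.sqrt (fine _)); rewrite unlock.
apply: ge0_ae_eq_integral => //.
- by apply/measurable_EFinP; exact: measurable_funM.
- by apply/measurable_EFinP; exact: measurable_funM.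
- by move=> x _; rewrite lee_fin -expr2 sqr_ge0.
- by move=> x _; rewrite lee_fin -expr2 sqr_ge0.
- by apply: filterS UV => x -> _.
Qed.

Lemma L2_ae (U V : T -> R) : measurable_fun [set: T] U -> L2 P V ->
  {ae P, forall x, U x = V x} -> L2 P U.
Proof.
move=> mU V2 UV; apply: L2_of_sq => //.
have := expectation_sqE V2; rewrite unlock => EV.
rewrite (@ge0_ae_eq_integral _ _ _ P setT _ (fun x => (V x ^+ 2)%:E)) ?EV ?ltry //.
- by apply/measurable_EFinP; exact: measurable_funX.
- by apply/measurable_EFinP; apply: measurable_funX; exact: L2_measurable V2.
- by move=> x _; rewrite lee_fin sqr_ge0.
- by move=> x _; rewrite lee_fin sqr_ge0.
- by apply: filterS UV => x -> _.
Qed.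

(** Almost surely [X t] is the real part of the spectral integral plus
    [xi * t ^ (d + 1)]. The integral depends on [t] through the kernel, which is Lipschitz
    in the sense required by [csq_punctured]. The variable [xi] is
    square-integrable, being the difference of [X 1] and the integral at [t = 1]. *)
Lemma spectral_ms_locally_lipschitz (d : nat) (X Y : R -> T -> R) (Cy : R -> R)
    (Zy Z : R -> T -> R[i]) (Fy : R -> R) (Xk : nat -> {RV P >-> R}) :
  second_order P X -> spectral_stationary P Y Cy Zy Fy ->
  spectral_representation P d.+1 X Zy Z (fun k => Xk k) ->
  (forall k : nat, (k < d.+1)%N -> {ae P, forall x, Xk k x = 0}) ->
  ms_locally_lipschitz P X.
Proof.
move=> X2 [[Fh [M FM]] [Zy2 Zyo] ZyF _ _] [ZE XE] Xk0.
have Zyorth u v u' v' : u <= v -> v <= u' -> u' <= v' ->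
    orth P (incr Zy u v) (incr Zy u' v').
  move=> uv vu uv'; apply/orthP; [exact: Zy2|exact: Zy2|exact: Zyo].
have ZyFE u v : u <= v -> csq P (incr Zy u v) = Fy v - Fy u.
  move=> uv; apply: EFin_inj; rewrite -ZyF // -expectation_sqmod //; exact: Zy2.
have /choice [I hI] : forall t, exists I, stieltjes_punctured P (taylor_kernel d.+1 t) Z I /\
    {ae P, forall x, (X t x)%:C = I x + (\sum_(k < d.+2) Xk k x * t ^+ k)%:C}.
  by move=> t; have [I h1 h2] := XE t; exists I.
have I2 t : L2C P (I t) := (hI t).1.1.
have reI2 t : L2 P (re (I t)) := (I2 t).1.
pose xi : T -> R := Xk d.+1.
have mxi : measurable_fun [set: T] xi by exact: measurable_funPT.
have Xae t : {ae P, forall x, X t x = re (I t) x + t ^+ d.+1 * xi x}.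
  have Xk0' : {ae P, forall x, forall k : 'I_d.+1, Xk k x = 0}.
    by apply: filter_forall => k; exact: Xk0.
  apply: filterS2 (hI t).2 Xk0' => x /(congr1 (@complex.Re R)) + xk0.
  rewrite big_ord_recr /= big1 ?add0r => [|k _]; last by rewrite xk0 mul0r.
  by rewrite /re mulrC; case: (I t x).
have xi2 : L2 P xi.
  apply: L2_ae mxi (L2B (X2 1) (reI2 1)) _.
  by apply: filterS (Xae 1) => x ->; rewrite expr1n mul1r addrAC subrr add0r.
move=> M0.
have [Lp Lp0 hLp] := loclip_poly ('X^(d.+1) : {poly R}) `|M0|.
have M_ge0 : 0 <= M := le_trans (normr_ge0 _) (FM 0).
pose B := 64 * 4 ^+ d.+1 * M * 2.
have B0 : 0 <= B by rewrite !mulr_ge0 // exprn_ge0.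
exists (Num.sqrt B * `|M0| ^+ d + Lp * nrm P xi).
  by rewrite addr_ge0 // mulr_ge0 ?sqrtr_ge0 ?exprn_ge0 ?nrm_ge0.
move=> s t sM tM.
have {}sM : `|s| <= `|M0| := le_trans sM (ler_norm _).
have {}tM : `|t| <= `|M0| := le_trans tM (ler_norm _).
have -> : nrm P (fun x => X t x - X s x) = nrm P (fun x =>
    re (fun x => I t x - I s x) x + (t ^+ d.+1 - s ^+ d.+1) * xi x).
  have D2 : L2 P (re (fun x => I t x - I s x)) := (L2CB (I2 t) (I2 s)).1.
  apply: nrm_ae.
  - exact: L2_measurable (L2B (X2 t) (X2 s)).
  - by apply: L2_measurable; apply: (L2D D2 (L2Z _ xi2)).
  - apply: filterS2 (Xae t) (Xae s) => x -> ->.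
    have -> : re (fun x => I t x - I s x) x = re (I t) x - re (I s) x.
      by rewrite /re; case: (I t x); case: (I s x).
    ring.
have D2 : L2 P (re (fun x => I t x - I s x)) := (L2CB (I2 t) (I2 s)).1.
apply: le_trans (nrmD D2 (L2Z _ xi2)) _.
rewrite mulrDl lerD //; last first.
  rewrite nrmZ // mulrAC ler_wpM2r ?nrm_ge0 //.
  by have := hLp s t sM tM; rewrite !hornerXn.
apply: le_trans (nrm_re_le P _) _.
have C0 : 0 <= 2 * (`|M0| ^+ d * `|t - s|) ^+ 2 by rewrite mulr_ge0 ?sqr_ge0.
have hk w := taylor_kernel_lipschitz d w sM tM.
have := csq_punctured Fh FM (fun u v => Zy2 u v) Zyorth ZyFE ZE C0 hk (hI t).1 (hI s).1.
have -> : 64 * 4 ^+ d.+1 * M * (2 * (`|M0| ^+ d * `|t - s|) ^+ 2) =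
  B * (`|M0| ^+ d * `|t - s|) ^+ 2 by rewrite /B; ring.
move=> h; apply: le_trans (ler_wsqrtr h) _.
by rewrite sqrtrM // sqrtr_sqr ger0_norm ?mulrA.
Qed.

End SpectralProcess.

Theorem theorem1 (disp : measure_display) (T : measurableType disp)
    (R : realType) (P : probability T R) (d : nat)
    (X Y : R -> T -> R) (Cy : R -> R)
    (Zy Z : R -> T -> R[i]) (Fy : R -> R) (Xk : nat -> {RV P >-> R})
    (d_ge1 : (1 <= d)%N)
    (X2 : second_order P X)
    (Y2 : second_order P Y)
    (YE : ms_nderivative P d X Y \/ generalized_nderivative P d X Y)
    (Y_stat : stationary P Y)
    (CyE : forall t h : R,
       'E_P[fun x => (Y (t + h) x * Y t x)%R]%E = (Cy h)%:E)
    (Cy_L2 : (\int[@lebesgue_measure R]_h (`|Cy h| ^+ 2)%:E < +oo)%E)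
    (Y_spec : spectral_stationary P Y Cy Zy Fy)
    (X_spec : spectral_representation P d X Zy Z (fun k => Xk k))
    (Xk0 : forall k : nat, (k < d)%N -> {ae P, forall x, Xk k x = 0}) :
  intrinsic_random_function P d X <-> stationary_increments P d X.
Proof.
have hX : ms_locally_lipschitz P X.
  by case: d d_ge1 X_spec Xk0 {YE} => // d _; exact: spectral_ms_locally_lipschitz Y_spec.
split; first exact: stationary_increments_of_intrinsic.
exact: intrinsic_of_stationary_increments.
Qed.
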